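(* Let $(X_n,Y_n)_{n\geq 0}$ be a diagonal random walk on $\mathbb{Z}^2$ started at $(x,y)\in\mathbb{Z}^2$, with transition probabilities depending only on $Y_n$ and satisfying $p_{j,1}+p_{j,2}>0$ and $p_{j,3}+p_{j,4}>0$ for every $j\in\mathbb{Z}$. Let $a\in\mathbb{Z}$, $a\neq y$, and $\tau_a=\min\{n\geq 0: Y_n=a\}$. Then the (possibly defective) probability mass function of the rescaled first passage location, $$k\mapsto \mathbb{P}\Bigl(\tau_a<\infty,\ \tfrac12\bigl(X(\tau_a)-x-|y-a|\bigr)=k\Bigr),\qquad k\in\mathbb{Z},$$ is a bell-shaped sequence, and it is given by the convolution of: (i) $A$ geometric sequences; (ii) $B$ reflected geometric sequences; (iii) at most $|y-a|$ reflected two-point sequences; (iv) an $\mathcal{AM}$-$\mathcal{CM}$ sequence; where $0\leq A\leq\lfloor\frac12(|y-a|-1)\rfloor$ and $0\leq B\leq\lfloor\frac12(|y-a|-1)\rfloor$.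
   Context: Diagonal random walk: a time-homogeneous Markov chain $(X_n,Y_n)$ on $\mathbb{Z}^2$ which from a point $(i,j)$ jumps to $(i+1,j+1)$, $(i-1,j+1)$, $(i-1,j-1)$, $(i+1,j-1)$ with probabilities $p_{j,1},p_{j,2},p_{j,3},p_{j,4}$ respectively, where $p_{j,1}+p_{j,2}+p_{j,3}+p_{j,4}=1$ (the probabilities depend only on the second coordinate $j$). We write $X(n)=X_n$. Sequences are real and indexed by $k\in\mathbb{Z}$. $\Delta a(k)=a(k+1)-a(k)$ and $\Delta^n=\Delta\Delta^{n-1}$. A sequence changes sign exactly $N$ times if $N$ is the largest number for which there are indices $k_0<k_1<\dots<k_N$ with $a(k_{j-1})a(k_j)<0$ for $j=1,\dots,N$. A nonnegative, not identically zero sequence $(a(k):k\in\mathbb{Z})$ is: - bell-shaped if it converges to zero at $\pm\infty$ and for every $n=1,2,\dots$ the sequence $\Delta^n a(k)$ changes sign exactly $n$ times; - $\mathcal{AM}$-$\mathcal{CM}$ (absolutely monotone then completely monotone) if $(a(k):k\geq0)$ and $(a(-k):k\geq 0)$ are both completely monotone, where $(c(k):k\geq0)$ is completely monotone if $(-1)^n\Delta^n c(k)\geq0$ for all $n,k=0,1,2,\dots$ A geometric sequence is $a(k)=p^k$ for $k\geq0$, $a(k)=0$ for $k<0$, with $p\in(0,1)$. A two-point sequence is $a(0)=p$, $a(1)=1-p$, $a(k)=0$ otherwise, with $p\in(0,1)$. The reflection of $a(k)$ is $a(-k)$. Convolution: $(a*b)(k)=\sum_{j\in\mathbb{Z}}a(k-j)b(j)$;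 a convolution of zero sequences is the sequence equal to $1$ at $0$ and $0$ elsewhere.
   Formalization: In (iii) a reflected two-point sequence may have parameter p=0 (unit mass at −1), but only if p_{j,4}=0 for some a<j≤y or p_{j,1}=0 for some y≤j<a; with p in (0,1) only, the claim fails, e.g. for p_{j,1}=p_{j,3}=1/2 and a<y. *)

(* Defs.v *)
From HB Require Import structures.
From mathcomp Require Import all_boot all_order all_algebra.
From mathcomp Require Import all_classical all_reals all_analysis.

Set Implicit Arguments.
Unset Strict Implicit.
Unset Printing Implicit Defensive.

Import Order.TTheory GRing.Theory Num.Theory.
Import numFieldNormedType.Exports.

Local Open Scope classical_set_scope.
Local Open Scope ring_scope.

(* Used both at T = int (two-sided sequences) and at T = nat. *)
Definition fdiff (R : zmodType) (T : pzSemiRingType) (u : T -> R) : T -> R :=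
  fun k => u (k + 1) - u k.

Section Sequences.
Variable R : realType.
Implicit Types u v : int -> R.

Definition has_sign_changes u (N : nat) :=
  exists k : nat -> int, forall j, (j < N)%N ->
    k j < k j.+1 /\ u (k j) * u (k j.+1) < 0.

Definition changes_sign_exactly u (N : nat) :=
  has_sign_changes u N /\ forall M, has_sign_changes u M -> (M <= N)%N.

Definition bell_shaped u :=
  [/\ forall k, 0 <= u k,
      exists k, u k != 0,
      u n%:Z @[n --> \oo] --> 0,
      u (- n%:Z) @[n --> \oo] --> 0 &
      forall n, (0 < n)%N -> changes_sign_exactly (iter n (@fdiff R int) u) n].

Definition completely_monotone (c : nat -> R) :=
  forall n k, 0 <= (-1) ^+ n * iter n (@fdiff R nat) c k.

Definition AM_CM u :=
  [/\ forall k, 0 <= u k,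
      exists k, u k != 0,
      completely_monotone (fun k : nat => u k%:Z) &
      completely_monotone (fun k : nat => u (- k%:Z))].

Definition geometric_seq (p : R) : int -> R :=
  fun k => if 0 <= k then p ^+ `|k|%N else 0.

Definition two_point_seq (p : R) : int -> R :=
  fun k => if k == 0 then p else if k == 1 then 1 - p else 0.

Definition reflection u : int -> R := fun k => u (- k).

Definition delta0 : int -> R := fun k => (k == 0)%:R.

(* The two-sided series is the sum of its positive part minus the sum of its
   negative part; [fine] is harmless when the series converges absolutely,
   e.g. when one sequence is summable and the other one is bounded. *)
Definition conv u v : int -> R := fun k =>
  let f := fun j : int => (u (k - j) * v j)%:E in
  fine (\esum_(j in [set: int]) (f^\+)%E j
        - \esum_(j in [set: int]) (f^\-)%E j)%E.

Definition convs (us : seq (int -> R)) : int -> R := foldr conv delta0 us.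

End Sequences.

Section RandomWalk.
Context (R : realType) (d : measure_display) (T : measurableType d).
Variable P : probability T R.

Definition cond_prob (A B : set T) : R := fine (P (A `&` B)) / fine (P B).

(* S is meant to be countable, with all its subsets measurable. *)
Definition markov_chain (S : Type) (Z : nat -> T -> S) (z0 : S)
    (q : S -> S -> R) :=
  [/\ forall n (A : set S), measurable (Z n @^-1` A),
      P [set w | Z 0%N w = z0] = 1%E &
      forall n (z : nat -> S) (z' : S),
        let past := [set w | forall m, (m <= n)%N -> Z m w = z m] in
        (0 < P past)%E ->
        cond_prob [set w | Z n.+1 w = z'] past = q (z n) z'].

Definition diagonal_step (p1 p2 p3 p4 : int -> R) (z z' : int * int) : R :=
  let: (i, j) := z in
  if z' == (i + 1, j + 1) then p1 j
  else if z' == (i - 1, j + 1) then p2 j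
  else if z' == (i - 1, j - 1) then p3 j
  else if z' == (i + 1, j - 1) then p4 j
  else 0.

Definition diagonal_walk (p1 p2 p3 p4 : int -> R) (X Y : nat -> T -> int)
    (x y : int) :=
  [/\ forall j, [/\ 0 <= p1 j, 0 <= p2 j, 0 <= p3 j & 0 <= p4 j],
      forall j, p1 j + p2 j + p3 j + p4 j = 1 &
      markov_chain (fun n w => (X n w, Y n w)) (x, y)
        (diagonal_step p1 p2 p3 p4)].

(* [None] stands for an infinite passage time. *)
Definition passage_time (Y : nat -> T -> int) (a : int) (w : T) : option nat :=
  if pselect (exists n, Y n w == a) is left h then Some (ex_minn h) else None.

Definition passage_pmf (X Y : nat -> T -> int) (x y a k : int) : R :=
  fine (P [set w | exists2 n, passage_time Y a w = Some n &
    (X n w - x - `|y - a|)%:~R / 2 = k%:~R :> R]).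

End RandomWalk.

(* A reflected two-point sequence comes from each level that has to be crossed,
   with parameter p4 j / (p3 j + p4 j) for a < j <= y when a < y, and
   p1 j / (p1 j + p2 j) for y <= j < a when y < a. The parameter lies in (0,1),
   except that it may be 0 (a unit shift to the left) if the numerator vanishes
   at some crossed level. This exception cannot be dropped: if
   p1 j = p3 j = 1/2 for all j and a < y, the passage location is the unit mass
   at -|y - a|, which is not a convolution of geometric, reflected geometric,
   reflected two-point (with parameter in (0,1)) and AM-CM sequences. *)
Definition two_point_parameter (R : realType) (p1 p4 : int -> R) (y a : int)
    (t : R) :=
  [/\ 0 <= t, t < 1 &
      t = 0 -> exists j, (y <= j < a) && (p1 j == 0)
                      || (a < j <= y) && (p4 j == 0)].

(* Main.v *)
(* Let up_j = al_j w + be_j and dn_j / w = de_j + ga_j / w be the weights of the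
   steps away from and towards the target level, levels being counted from the
   target, and let l be the starting level.  Decomposing at the last visit to
   level l, the generating function of the passage location is
     (prod_(j <= l) dn_j / w) * G / K,
   where G is the Green function at level l of the walk killed at the target
   and K is the determinant of the walk on the levels 1, ..., l - 1.  Every
   ratio of consecutive such determinants is 1 / (1 - q H) with
   q = up_j dn_(j+1) / w and H the preceding ratio.  If (1 - w) H is a complete
   Bernstein function of -w, then (1 - q H) / (1 - w) is a Stieltjes function of
   -w, so the property passes to 1 / (1 - q H).  Hence the zeros of K are real,
   positive, at most (l - 1) / 2 of them on either side of 1, and they give the
   geometric factors.  The same argument, applied to 1 / (1 - q H - q' H') for
   the walk truncated at a high level, shows that G is AM-CM.

   The differences of order n of an AM-CM sequence have at most n sign changes;
   convolution with geometric and two-point sequences does not increase this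
   number, and Rolle's theorem yields the lower bound. *)
Require Import Defs.
From HB Require Import structures.
From mathcomp Require Import all_boot all_order all_algebra.
From mathcomp Require Import all_classical all_reals all_analysis.
From mathcomp Require Import ring lra zify.
Import Order.TTheory GRing.Theory Num.Theory.
Import numFieldNormedType.Exports.
Set Implicit Arguments.
Unset Strict Implicit.
Unset Printing Implicit Defensive.
Local Open Scope classical_set_scope.
Local Open Scope ring_scope.

(** * Rational functions with interlacing zeros and poles *)

Section PartialFractions.
Variable F : fieldType.
Implicit Types (h w v : F) (s ns : seq F) (e : F -> F) (p : {poly F}).

(** Only boundedness of the Green function and of the passage sequence is used, so no generating
    function is ever summed. A polynomial acts on a two-sided sequence with ['X] as the shift,
    identities are kept in cleared form, and a factor is cancelled when it acts injectively on
    bounded sequences. Powers of ['X] and factors ['X - v] with [v] positive and different from [1]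
    qualify, which is why zeros must be kept away from [1]. Division by [1 - w] adds a pole at [1].
    Its coefficient is positive because killing makes the walk strictly substochastic; as zeros
    interlace poles, counting on both sides of this pole locates the zeros relative to [1]. Below
    the starting level everything is rational. Above it the continued fraction is infinite; cutting
    the up steps at a high level makes it finite, and complete monotonicity survives the pointwise
    limit. Convolutions are not evaluated either: the linear factor inverse to a geometric sequence
    is applied to the passage sequence, and the same identity transports the bound on sign
    changes. *)

Definition prodX s : {poly F} := \prod_(v <- s) ('X - v%:P).

Definition pfrac h ns e w : F := h + \sum_(v <- ns) e v / (w - v).

Definition pfrac_num h ns e : {poly F} :=
  h *: prodX ns + \sum_(v <- ns) e v *: prodX (rem v ns).

Lemma prodX_cons v s : prodX (v :: s) = ('X - v%:P) * prodX s.
Proof. by rewrite /prodX big_cons. Qed.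

Lemma prodX_cat s1 s2 : prodX (s1 ++ s2) = prodX s1 * prodX s2.
Proof. by rewrite /prodX big_cat. Qed.

Lemma prodX_rem v s : v \in s -> prodX s = ('X - v%:P) * prodX (rem v s).
Proof. by move=> vs; rewrite -prodX_cons; apply/perm_big/perm_to_rem. Qed.

Lemma horner_prodX_eq0 s w : ((prodX s).[w] == 0) = (w \in s).
Proof. by rewrite -root_prod_XsubC. Qed.

Lemma horner_prodX_rem v s w :
  v \in s -> w != v -> (prodX (rem v s)).[w] = (prodX s).[w] / (w - v).
Proof.
move=> vs wv; rewrite (prodX_rem vs) hornerM hornerXsubC mulrC mulKf //.
by rewrite subr_eq0.
Qed.

Lemma horner_pfrac_num h ns e w : w \notin ns ->
  (pfrac_num h ns e).[w] = (prodX ns).[w] * pfrac h ns e w.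
Proof.
move=> wns; rewrite /pfrac_num /pfrac hornerD hornerZ mulrDr mulrC; congr (_ + _).
rewrite horner_sum mulr_sumr !big_seq; apply: eq_bigr => v vns.
rewrite hornerZ horner_prodX_rem //; last by apply: contraNneq wns => ->.
by rewrite mulrCA.
Qed.

Lemma horner_pfrac_num_pole h ns e v : uniq ns -> v \in ns ->
  (pfrac_num h ns e).[v] = e v * (prodX (rem v ns)).[v].
Proof.
move=> uns vns; rewrite /pfrac_num hornerD hornerZ.
have /eqP -> : (prodX ns).[v] == 0 by rewrite horner_prodX_eq0.
rewrite mulr0 add0r horner_sum (big_rem v) //= hornerZ big_seq big1 ?addr0 // => u.
rewrite mem_rem_uniq // inE => /andP[uv uns'].
have /eqP : (prodX (rem u ns)).[v] == 0.
  by rewrite horner_prodX_eq0 mem_rem_uniq // inE eq_sym uv.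
by rewrite hornerZ => ->; rewrite mulr0.
Qed.

Lemma size_prodX s : size (prodX s) = (size s).+1.
Proof. exact: size_prod_XsubC. Qed.

Lemma monic_prodX s : prodX s \is monic.
Proof. exact: monic_prod_XsubC. Qed.

Lemma size_sum_prodX_rem ns e :
  (size (\sum_(v <- ns) e v *: prodX (rem v ns))%R <= size ns)%N.
Proof.
rewrite big_seq; apply: (leq_trans (size_sum _ _ _)).
apply/bigmax_leqP_seq => v vns _; apply: (leq_trans (size_scale_leq _ _)).
by rewrite size_prodX size_rem // prednK //; case: (ns) vns.
Qed.

Lemma size_pfrac_num h ns e : (size (pfrac_num h ns e) <= (size ns).+1)%N.
Proof.
apply: (leq_trans (size_polyD _ _)); rewrite geq_max.
rewrite (leq_trans (size_scale_leq _ _)) ?size_prodX //.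
exact/leqW/size_sum_prodX_rem.
Qed.

Lemma lead_coef_prodX s : (prodX s)`_(size s) = 1.
Proof. by have /monicP := monic_prodX s; rewrite lead_coefE size_prodX. Qed.

Lemma coef_pfrac_num h ns e : (pfrac_num h ns e)`_(size ns) = h.
Proof.
rewrite coefD coefZ lead_coef_prodX mulr1.
by rewrite [X in _ + X]nth_default ?addr0 // size_sum_prodX_rem.
Qed.

Lemma size_pfrac_num_neq0 h ns e :
  h != 0 -> size (pfrac_num h ns e) = (size ns).+1.
Proof.
move=> h0; apply/eqP; rewrite eqn_leq size_pfrac_num /= leqNgt.
by apply/negP => /leq_sizeP/(_ _ (leqnn _)) /eqP; rewrite coef_pfrac_num (negPf h0).
Qed.

Lemma coef_pfrac_num0 v ns e :
  (pfrac_num 0 (v :: ns) e)`_(size ns) = \sum_(u <- v :: ns) e u.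
Proof.
rewrite coefD coefZ mul0r add0r coef_sum !big_seq; apply: eq_bigr => u uns.
have su : size (rem u (v :: ns)) = size ns by rewrite size_rem.
by rewrite coefZ -su lead_coef_prodX mulr1.
Qed.

(** Lagrange interpolation: both sides agree at the nodes and in the coefficient of degree
    [size ns], so their difference has more roots than its degree allows. *)
Lemma pfrac_decomposition p ns : uniq ns -> (size p <= (size ns).+1)%N ->
  p = pfrac_num p`_(size ns) ns (fun v => p.[v] / (prodX (rem v ns)).[v]).
Proof.
move=> uns sp; set q := pfrac_num _ _ _; apply/eqP; rewrite -subr_eq0; apply/eqP.
apply: (roots_geq_poly_eq0 (rs := ns)) => //.
  apply/allP => v vns; rewrite rootE hornerD hornerN horner_pfrac_num_pole //.
  rewrite mulfVK ?subrr // horner_prodX_eq0 mem_rem_uniqF //.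
apply/leq_sizeP => i; rewrite leq_eqVlt => /orP[/eqP <-|ltni].
  by rewrite coefB coef_pfrac_num subrr.
by rewrite coefB !nth_default ?subrr // (leq_trans _ ltni) // size_pfrac_num.
Qed.

End PartialFractions.

(** * Zeros between consecutive poles *)

Section Interlacing.
Variable R : rcfType.
Implicit Types (p : {poly R}) (a b w x : R) (ls ns s : seq R) (c e : R -> R).

Lemma poly_ivt_sign p a b : a < b -> p.[a] * p.[b] < 0 ->
  exists2 x, a < x < b & root p x.
Proof.
move=> ltab pab.
have [pa0 pb0] : p.[a] != 0 /\ p.[b] != 0.
  by split; apply: contraTneq pab => ->; rewrite ?mul0r ?mulr0 ltxx.
have [x /andP[ax xb] rx] : exists2 x, a <= x <= b & root p x.
  have [pa|pa|/eqP] := ltgtP p.[a] 0; last by rewrite (negPf pa0).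
    by apply: poly_ivt (ltW ltab) _; rewrite (ltW pa) /= ltW // -(nmulr_rlt0 _ pa).
  have [|x xab rx] := @poly_ivt _ (- p) _ _ (ltW ltab).
    by rewrite !hornerN oppr_le0 (ltW pa) /= oppr_ge0 ltW // -(pmulr_rlt0 _ pa).
  by exists x; rewrite // -rootN.
exists x => //; rewrite !lt_neqAle ax xb !andbT; apply/andP; split.
  by apply: contraNneq pa0 => ->.
by apply: contraNneq pb0 => <-.
Qed.

(** Each gap contains one root. Interlacing is recorded by counting on both sides of each node
    because the counts at the node [1] are what finally bounds the number of geometric factors. *)
Lemma interlacing_roots p a s :
  path (fun x y => (x < y) && (p.[x] * p.[y] < 0)) a s ->
  exists ns, [/\ size ns = size s, path <%R a ns, all (root p) ns &
    forall t, t \in a :: s ->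
      [/\ t \notin ns, count (< t) ns = count (< t) (a :: s) &
          count (> t) ns = count (> t) (a :: s)]].
Proof.
elim: s a => [|b s IH] a.
  by exists [::]; split=> // t; rewrite inE => /eqP -> /=; rewrite ltxx.
rewrite /= => /andP[/andP[ltab pab] hs].
have [x /andP[ax xb] rx] := poly_ivt_sign ltab pab.
have [ns [sz srt rts cnt]] := IH _ hs.
have hbs : path <%R b s by apply: sub_path hs => ? ? /andP[].
have xns : path <%R x ns.
  by case: (ns) srt => //= z ? /andP[bz ->]; rewrite (lt_trans xb bz).
exists (x :: ns); split=> /=; rewrite ?sz ?ax ?rx //.
have absort : path <%R a (b :: s) by rewrite /= ltab.
have anssort : path <%R a (x :: ns) by rewrite /= ax.
have lt_all (z : R) u : path <%R z u -> all (> z) u by apply/order_path_min/lt_trans.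
move=> t; rewrite in_cons => /orP[/eqP ->|tbs].
  have A1 := lt_all _ _ absort; have A2 := lt_all _ _ anssort.
  rewrite ltxx /= !add0n; split.
  - by apply/negP => /(allP A2); rewrite ltxx.
  - have cnt0 u : all (> a) u -> count (< a) u = 0%N.
      elim: u => //= z u IHu /andP[az /IHu ->]; by rewrite ltNge (ltW az).
    by have := cnt0 _ A1; have := cnt0 _ A2 => /= -> ->.
  - have cnts u : all (> a) u -> count (> a) u = size u by rewrite all_count => /eqP.
    by have := cnts _ A1; have := cnts _ A2 => /= -> ->; rewrite sz.
have [tns cl cr] := cnt _ tbs.
have bt : b <= t.
  move: tbs; rewrite in_cons => /orP[/eqP -> //|/(allP (lt_all _ _ hbs))/ltW //].
have xt := lt_le_trans xb bt; have at_ := lt_trans ax xt.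
rewrite /= in cl cr; rewrite in_cons negb_or tns (gt_eqF xt) cl cr at_ xt.
by rewrite !ltNge (ltW xt) (ltW at_).
Qed.

Lemma sorted_consecutive (r : rel R) s : sorted <%R s ->
  {in s &, forall x y, x < y -> (forall z, z \in s -> ~~ (x < z < y)) -> r x y} ->
  sorted r s.
Proof.
move=> srt hr; apply/(sortedP 0) => i lti.
have lti' : (i < size s)%N by exact: ltnW.
apply: hr; rewrite ?mem_nth //.
  by rewrite (lt_sorted_ltn_nth _ srt).
move=> z /(nthP 0)[k ltk <-]; apply/negP.
by rewrite !(lt_sorted_ltn_nth _ srt) ?inE // ltnS => /andP[/leq_trans h /h]; rewrite ltnn.
Qed.

(* Numerator of [A + sum_l c l / (l - w)] over the monic denominator [prodX ls]. *)
Definition stieltjes_num (A : R) ls c := pfrac_num A ls (fun l => - c l).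

(** At a node [a] the numerator is [- c a] times the product of the [a - z]. In the product of the
    two values, [(a - z) * (b - z)] is positive for every other node, none lying between, so
    [(a - b) * (b - a)] decides the sign. *)
Lemma stieltjes_num_sign A ls c a b : uniq ls -> {in ls, forall l, 0 < c l} ->
  a \in ls -> b \in ls -> a < b -> (forall z, z \in ls -> ~~ (a < z < b)) ->
  (stieltjes_num A ls c).[a] * (stieltjes_num A ls c).[b] < 0.
Proof.
move=> uls c0 als bls ab hab.
rewrite !horner_pfrac_num_pole // !mulNr mulrN opprK mulrACA.
rewrite pmulr_rlt0 ?mulr_gt0 ?c0 //.
have bra : b \in rem a ls by rewrite mem_rem_uniq // inE (gt_eqF ab).
have arb : a \in rem b ls by rewrite mem_rem_uniq // inE (lt_eqF ab).
rewrite (prodX_rem bra) (prodX_rem arb).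
have -> : prodX (rem a (rem b ls)) = prodX (rem b (rem a ls)).
  apply/perm_big/uniq_perm; rewrite ?rem_uniq // => z.
  by rewrite !mem_rem_uniq ?rem_uniq // !inE !mem_rem_uniq // !inE andbCA.
rewrite !hornerM !hornerXsubC mulrACA nmulr_rlt0; last first.
  by rewrite nmulr_rlt0 ?subr_lt0 ?subr_gt0.
rewrite /prodX !horner_prod -big_split big_seq prodr_gt0 //= => z zin.
have zls : z \in ls by exact: (mem_rem (mem_rem zin)).
rewrite !hornerXsubC.
move: zin; rewrite !mem_rem_uniq ?rem_uniq // inE mem_rem_uniq // inE => /and3P[zb za _].
have := hab z zls; rewrite negb_and -!leNgt => /orP[za'|bz].
  have za2 : z < a by rewrite lt_neqAle za.
  by rewrite mulr_gt0 ?subr_gt0 // (lt_trans za2).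
have zb2 : b < z by rewrite lt_neqAle eq_sym zb.
by rewrite nmulr_rgt0 ?subr_lt0 // (lt_trans ab).
Qed.

Lemma stieltjes_num_sign_oo A ls c a : uniq ls -> {in ls, forall l, 0 < c l} ->
  0 < A -> a \in ls -> {in ls, forall l, l <= a} ->
  exists2 b, a < b & (stieltjes_num A ls c).[a] * (stieltjes_num A ls c).[b] < 0.
Proof.
move=> uls c0 A0 als amax; set S := \sum_(l <- ls) c l.
have S0 : 0 <= S by rewrite /S big_seq sumr_ge0 // => l /c0/ltW.
(* All nodes are at distance at least [1 + S / A] from [b], so the pole terms add up to at most
   [S / (1 + S / A)], which is less than [A]. *)
pose b := a + 1 + S / A.
have SA : 0 <= S / A by rewrite divr_ge0 // ltW.
have ab : a < b by rewrite /b; lra.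
exists b => //.
have lb l : l \in ls -> l < b by move=> /amax/le_lt_trans; apply.
have bls : b \notin ls by apply/negP => /lb; rewrite ltxx.
rewrite horner_pfrac_num_pole // horner_pfrac_num // !mulNr oppr_lt0.
apply: mulr_gt0; last apply: mulr_gt0.
- apply: mulr_gt0; first exact: c0.
  rewrite /prodX horner_prod big_seq prodr_gt0 // => z.
  rewrite mem_rem_uniq // inE => /andP[za zls].
  by rewrite hornerXsubC subr_gt0 lt_neqAle za amax.
- by rewrite /prodX horner_prod big_seq prodr_gt0 // => z zls; rewrite hornerXsubC subr_gt0 lb.
rewrite /pfrac.
have : \sum_(l <- ls) c l / (b - l) <= S / (1 + S / A).
  have -> : S / (1 + S / A) = \sum_(l <- ls) c l / (1 + S / A) by rewrite -mulr_suml.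
  rewrite big_seq [X in _ <= X]big_seq ler_sum // => l lls.
  rewrite ler_wpM2l ?(ltW (c0 _ lls)) // lef_pV2 ?posrE ?subr_gt0 ?lb //.
    by have := amax _ lls; rewrite /b; lra.
  lra.
have : S / (1 + S / A) < A.
  have h : 0 < 1 + S / A by lra.
  rewrite ltr_pdivrMr // mulrDr mulr1 mulrCA divff ?gt_eqF // mulr1; lra.
under [X in _ -> _ -> 0 < _ + X]eq_bigr do rewrite mulNr.
rewrite sumrN; lra.
Qed.
End Interlacing.

(** * Reciprocals of Stieltjes functions *)

Section Inversion.
Variable R : rcfType.
Implicit Types (p : {poly R}) (h k w v : R) (ls ns s : seq R) (c e : R -> R).

Lemma pfracZ k h ns e w : pfrac (k * h) ns (fun v => k * e v) w = k * pfrac h ns e w.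
Proof.
rewrite /pfrac mulrDr mulr_sumr; congr (_ + _).
by apply: eq_bigr => v _; rewrite mulrA.
Qed.

(** Subtracting the value at the zero [v] termwise replaces [c l / (l - w)] by
    [(w - v) * (c l / (l - v)) / (l - w)]. *)
Lemma stieltjes_num_root A ls c v : v \notin ls -> root (stieltjes_num A ls c) v ->
  stieltjes_num A ls c = ('X - v%:P) * stieltjes_num 0 ls (fun l => c l / (l - v)).
Proof.
move=> vls; rewrite rootE horner_pfrac_num // mulf_eq0 horner_prodX_eq0 (negPf vls) /=.
rewrite /pfrac => /eqP hA.
rewrite /stieltjes_num /pfrac_num scale0r add0r mulr_sumr.
transitivity (\sum_(l <- ls) (- (c l / (l - v)) *: prodX ls + - c l *: prodX (rem l ls))).
  rewrite big_split /=; congr (_ + _); rewrite -scaler_suml; congr (_ *: _).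
  apply/eqP; rewrite -subr_eq0 -[X in _ == X]hA; apply/eqP; congr (_ + _).
  rewrite -sumrN; apply: eq_bigr => l _.
  by rewrite opprK -[v - l]opprB invrN mulrN mulNr opprK.
rewrite big_seq [RHS]big_seq; apply: eq_bigr => l lls.
have lv : l - v != 0 by rewrite subr_eq0; apply: contraNneq vls => <-.
rewrite (prodX_rem lls) -!mul_polyC.
have -> : - c l = - (c l / (l - v)) * (l - v) by field.
rewrite polyCM polyCB; ring.
Qed.

(* Here [A = 0] gives [F'(v) > 0], hence the sign of the residue of [1 / F]. *)
Lemma stieltjes_num_residue A ls c v : {in ls, forall l, 0 < c l} ->
  v \notin ls -> ls != [::] ->
  exists2 t, 0 < t & (stieltjes_num A ls (fun l => c l / (l - v))).[v] =
    (prodX ls).[v] * (A + t).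
Proof.
move=> c0 vls lsn; exists (\sum_(l <- ls) c l / (l - v) ^+ 2).
  have lv l : l \in ls -> 0 < c l / (l - v) ^+ 2.
    move=> lls; rewrite divr_gt0 ?c0 // exprn_even_gt0 // subr_eq0.
    by apply: contraNneq vls => <-.
  case: ls lsn {c0 vls} lv => // a s _ lv; rewrite big_cons ltr_pwDl ?lv ?mem_head //.
  by rewrite big_seq sumr_ge0 // => l ls; rewrite ltW // lv // in_cons ls orbT.
rewrite horner_pfrac_num // /pfrac; congr (_ * (_ + _)); apply: eq_bigr => l _.
by rewrite -[v - l]opprB invrN mulrNN expr2 invfM mulrA.
Qed.

(* Rational generating functions of AM-CM sequences: [h] and [pfrac h ns e 0]
   are the values at infinity and at [0]; expanding in the annulus containing
   [1], a pole below (above) [1] contributes to the negative (nonnegative)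
   indices with a coefficient of the sign of [e v * (1 - v)]. *)
Definition amcm_frac h ns e :=
  [/\ 0 <= h, uniq ns, {in ns, forall v, 0 < v /\ 0 < e v * (1 - v)} &
      0 <= pfrac h ns e 0].

Lemma amcm_frac_nil : amcm_frac 0 [::] (fun=> 0).
Proof. by split=> //; rewrite /pfrac big_nil addr0. Qed.

(** The sign changes between neighbouring nodes, with one more beyond the largest node when [0 < A],
    already give as many roots as the degree allows. Hence the numerator splits with simple roots,
    all of them to the right of the smallest node. *)
Lemma stieltjes_roots A ls c :
  uniq ls -> ls != [::] -> 0 <= A -> {in ls, forall l, 0 <= l /\ 0 < c l} ->
  let N := stieltjes_num A ls c in
  exists k ns, [/\ k != 0, N = k *: prodX ns, uniq ns,
   {in ns, forall v, 0 < v /\ v \notin ls} &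
   size ns = ((size ls).-1 + (0 < A)%R)%N /\
   {in ls, forall l, count (< l) ns = count (< l) ls /\
                     count (> l) ns = (count (> l) ls + (0 < A)%R)%N}].
Proof.
move=> uls lsn A0 hc N.
have c0 : {in ls, forall l, 0 < c l} by move=> l /hc[].
have: sorted <%R (sort <=%R ls) by rewrite sort_lt_sorted.
have mems l : (l \in sort <=%R ls) = (l \in ls) by rewrite mem_sort.
have szs := size_sort <=%R ls; have pms := permEl (perm_sort <=%R ls).
case: (sort <=%R ls) mems szs pms => [|a s] mems szs pms srt.
  by move: lsn; rewrite -size_eq0 -szs.
have ps : path (fun x y => (x < y) && (N.[x] * N.[y] < 0)) a s.
  apply: (sorted_consecutive srt) => x y; rewrite !mems => xls yls xy hxy.
  by rewrite xy stieltjes_num_sign // => z zls; apply: hxy; rewrite mems.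
have [t [ns [[sz srtn rts cnt] [szt szN]]]] : exists t ns : seq R, [/\ size ns = size t, path <%R a ns,
    all (root N) ns & forall l, l \in ls ->
      [/\ l \notin ns, count (< l) ns = count (< l) ls &
          count (> l) ns = (count (> l) ls + (0 < A)%R)%N]] /\
    (size t = size s + (0 < A)%R)%N /\ size N = (size t).+1.
  have cntE (P : pred R) : count P (a :: s) = count P ls by apply/permP.
  have [A1|A1|A1] := ltgtP 0 A; last 1 first.
  - have [ns [sz srtn rts cnt]] := interlacing_roots ps.
    exists s, ns; split; first split=> // l; rewrite ?A1 ?addn0.
      by rewrite -mems => /cnt; rewrite !cntE.
    split=> //; rewrite /N -A1 [(size s).+1]szs /stieltjes_num.
    apply/eqP; rewrite eqn_leq; apply/andP; split.
      by rewrite /pfrac_num scale0r add0r size_sum_prodX_rem.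
    case: (ls) hc lsn => // b u hc _ /=.
    rewrite ltnNge; apply/negP => /leq_sizeP/(_ _ (leqnn _)) /eqP.
    rewrite coef_pfrac_num0 sumrN oppr_eq0 => /eqP; apply/eqP; rewrite gt_eqF //.
    rewrite big_cons ltr_pwDl //; first by case: (hc b); rewrite ?mem_head.
    by rewrite big_seq sumr_ge0 // => l lu; rewrite ltW //; case: (hc l); rewrite // in_cons lu orbT.
  - have lastls : last a s \in ls by rewrite -mems mem_last.
    have lmax : {in ls, forall l, l <= last a s}.
      move=> l; rewrite -mems => /(nthP 0)[i lti <-].
      by rewrite (last_nth 0) (lt_sorted_leq_nth _ srt) // ?inE ?ltnS.
    have [b ltb Nb] := stieltjes_num_sign_oo uls c0 A1 lastls lmax.
    have pb : path (fun x y => (x < y) && (N.[x] * N.[y] < 0)) a (rcons s b).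
      by rewrite rcons_path ps ltb.
    have [ns [sz srtn rts cnt]] := interlacing_roots pb.
    exists (rcons s b), ns; split; first split=> // l lls.
      have lb : l < b by exact: le_lt_trans (lmax _ lls) ltb.
      have := cnt l; rewrite -rcons_cons mem_rcons in_cons mems lls orbT => /(_ isT).
      by rewrite -!cats1 !count_cat !cntE /= lb ltNge (ltW lb) !addn0.
    by rewrite size_rcons addn1 size_pfrac_num_neq0 ?gt_eqF // -szs.
  - by move: A0; rewrite leNgt A1.
have uns : uniq ns by move: srtn => /path_sorted/lt_sorted_uniq.
exists (lead_coef N), ns; split=> //.
- by rewrite lead_coef_eq0 -size_poly_eq0 szN.
- by rewrite {1}(all_roots_prod_XsubC _ rts) // ?szN ?sz // uniq_rootsE.
- move=> v vns; split; last by apply/negP => /cnt[/negP].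
  have [a0 _] : 0 <= a /\ 0 < c a by apply: hc; rewrite -mems mem_head.
  by apply: le_lt_trans a0 _; apply: (allP (order_path_min lt_trans srtn)).
- by split; [rewrite sz szt -szs | move=> l /cnt[]].
Qed.

(* [F(w) = A + c1 / (1 - w) + sum_l c l / (l - w)] is a Stieltjes function of
   [-w]: it increases between consecutive poles, so its zeros interlace them,
   and [1 / ((1 - w) F(w))] has the required partial fractions. *)
Lemma amcm_inversion (A c1 : R) ls c :
  uniq ls -> 1 \notin ls -> {in ls, forall l, 0 <= l /\ 0 < c l} -> 0 < c1 -> 0 <= A ->
  exists h ns e k, [/\ amcm_frac h ns e, k != 0,
   [/\ count (< 1%R) ns = count (< 1%R) ls,
       count (> 1%R) ns = (count (> 1%R) ls + (0 < A)%R)%N,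
       (h == 0) = (0 < A) & (pfrac h ns e 0 == 0) = (0 \in ls)],
   forall w, w \notin ls -> w != 1 ->
     (1 - w) * (A + c1 / (1 - w) + \sum_(l <- ls) c l / (l - w)) * (prodX ls).[w]
     = k * (prodX ns).[w] &
   forall w, w \notin ns -> (prodX ls).[w] = k * (prodX ns).[w] * pfrac h ns e w].
Proof.
move=> uls ls1 hc c10 A0.
pose ls' := 1 :: ls; pose c' l := if l == 1 then c1 else c l.
have hc' : {in ls', forall l, 0 <= l /\ 0 < c' l}.
  move=> l; rewrite inE /c'; case: eqVneq => [-> //|_ /hc //].
have c'0 : {in ls', forall l, 0 < c' l} by move=> l /hc'[].
have uls' : uniq ls' by rewrite /= ls1.
have [k [ns [k0 Nk uns hns [szns cnt]]]] := stieltjes_roots uls' isT A0 hc'.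
set N := stieltjes_num A ls' c' in Nk *.
have NE w : w \notin ls -> w != 1 ->
    (1 - w) * (A + c1 / (1 - w) + \sum_(l <- ls) c l / (l - w)) * (prodX ls).[w] = - N.[w].
  move=> wls w1; have wls' : w \notin ls' by rewrite inE negb_or w1.
  rewrite horner_pfrac_num // prodX_cons hornerM hornerXsubC /pfrac big_cons {1}/c' eqxx.
  rewrite -!mulNr opprB [RHS]mulrAC; congr (_ * _ * _).
  rewrite -addrA; congr (_ + (_ + _)); first by rewrite -[w - 1]opprB invrN mulNr mulrN opprK.
  rewrite big_seq [RHS]big_seq; apply: eq_bigr => l lls.
  rewrite /c'; case: eqVneq => [l1|_]; first by rewrite -l1 lls in ls1.
  by rewrite -[w - l]opprB invrN mulNr mulrN opprK.
have szF : (size (prodX ls) <= (size ns).+1)%N by rewrite size_prodX ltnS szns leq_addr.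
have FE := pfrac_decomposition uns szF.
(* Coefficients of the partial fractions of [prodX ls / (- k * prodX ns)], which is the reciprocal
   of [(1 - w) * F(w)]. When [0 < A] the denominator has the larger degree and [h] vanishes. *)
pose h := (- k)^-1 * (prodX ls)`_(size ns).
pose e v := (- k)^-1 * ((prodX ls).[v] / (prodX (rem v ns)).[v]).
have eval_F w : w \notin ns -> (prodX ls).[w] = (- k) * (prodX ns).[w] * pfrac h ns e w.
  move=> wns; rewrite pfracZ {1}FE horner_pfrac_num //.
  by rewrite mulrACA mulfV ?mul1r // oppr_eq0.
have hA : h = if 0 < A then 0 else (- k)^-1.
  rewrite /h szns; case: ltP => _.
    by rewrite addn1 nth_default ?mulr0 // size_prodX.
  by rewrite addn0 lead_coef_prodX mulr1.
have k_lt0 : ~~ (0 < A) -> k < 0.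
  rewrite lt_neqAle A0 andbT negbK => /eqP A00.
  have : N`_(size ls) = k.
    rewrite Nk coefZ; have -> : size ls = size ns by rewrite szns -A00 ltxx addn0.
    by rewrite lead_coef_prodX mulr1.
  move=> <-; rewrite /N -A00 /stieltjes_num coef_pfrac_num0 sumrN oppr_lt0 big_cons.
  rewrite ltr_pwDl ?c'0 ?mem_head // big_seq sumr_ge0 // => l lls.
  by rewrite ltW // c'0 // in_cons lls orbT.
have ens v : v \in ns -> 0 < e v * (1 - v).
  move=> vns; have [v0 vls'] := hns _ vns.
  have Nv : root N v by rewrite Nk rootZ // root_prod_XsubC.
  have := stieltjes_num_root vls' Nv; rewrite -/N Nk (prodX_rem vns) scalerAr.
  move/(mulfI (negbT (polyXsubC_eq0 v)))/(congr1 (horner^~ v)).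
  have [t t0 ->] := stieltjes_num_residue 0 c'0 vls' isT.
  rewrite hornerZ add0r prodX_cons hornerM hornerXsubC => kE.
  move: vls'; rewrite inE negb_or => /andP[v1 vls].
  have F0 : (prodX ls).[v] != 0 by rewrite horner_prodX_eq0.
  have G0 : (prodX (rem v ns)).[v] != 0 by rewrite horner_prodX_eq0 mem_rem_uniqF.
  have -> : e v * (1 - v) = t^-1; last by rewrite invr_gt0.
  have v10 : v - 1 != 0 by rewrite subr_eq0.
  have : e v = - ((k * (prodX (rem v ns)).[v])^-1 * (prodX ls).[v]).
    by rewrite /e invrN invfM mulNr; congr (- _); rewrite -!mulrA; congr (_ * _); rewrite mulrC.
  by rewrite kE => ->; field; rewrite gt_eqF // F0.
exists h, ns, e, (- k).
have ns0 : 0 \notin ns by apply/negP => /hns[]; rewrite ltxx.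
(* At [0] the reciprocal of [F] vanishes if [F] has a pole there; otherwise its value is [1 / r]
   with [r = F(0)] positive. *)
have p0 : if 0 \in ls then pfrac h ns e 0 = 0 else 0 < pfrac h ns e 0.
  have := eval_F _ ns0; case: ifPn => l0.
    have /eqP -> : (prodX ls).[0] == 0 by rewrite horner_prodX_eq0.
    move/esym/eqP; rewrite !mulf_eq0 horner_prodX_eq0 (negPf ns0) oppr_eq0 (negPf k0).
    by move/eqP.
  have n01 : (0 : R) != 1 by rewrite eq_sym oner_eq0.
  have F0 : (prodX ls).[0] != 0 by rewrite horner_prodX_eq0.
  have := NE _ l0 n01; rewrite Nk hornerZ -mulNr => <-.
  rewrite subr0 mul1r divr1; set r := A + c1 + _ => hr.
  have {}hr : r * pfrac h ns e 0 = 1.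
    by apply: (mulfI F0); rewrite mulr1 mulrCA mulrA -hr.
  have r0 : 0 < r.
    rewrite /r ltr_wpDr ?ltr_wpDl // big_seq sumr_ge0 // => l /hc[l00 /ltW cl].
    by rewrite subr0 divr_ge0.
  by rewrite -(pmulr_rgt0 _ r0) hr.
split=> //.
- split=> //; first by rewrite hA; case: ltP => // /le_gtF/negbT/k_lt0; rewrite invr_ge0 oppr_ge0 => /ltW.
    by move=> v vns; split; [case: (hns _ vns)|exact: ens].
  by move: p0; case: ifP => _ => [->|/ltW].
- by rewrite oppr_eq0.
- have [c1E c2E] := cnt 1 (mem_head _ _).
  split; rewrite ?c1E ?c2E /= ?ltxx ?add0n //.
    by rewrite hA; case: ltP; rewrite ?eqxx // invr_eq0 oppr_eq0 (negPf k0).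
  by move: p0; case: ifP => _ => [->|/gt_eqF]; rewrite ?eqxx.
- by move=> w wls w1; rewrite NE // Nk hornerZ mulNr.
Qed.

End Inversion.

(** * Continued fractions with quadratic weights *)

Section Continuants.
Variable R : rcfType.
Implicit Types (p : {poly R}) (h k w v : R) (ls ns s : seq R) (e : R -> R).

Lemma poly_eq_cofinite p q s :
  (forall w, w \notin s -> p.[w] = q.[w]) -> p = q.
Proof.
move=> hpq; apply/eqP; rewrite -subr_eq0.
have : (p - q) * prodX s == 0; last first.
  by rewrite mulf_eq0 (negPf (monic_neq0 (monic_prodX s))) orbF.
set r := _ * _; apply/eqP.
apply: (@roots_geq_poly_eq0 _ _ [seq i%:R | i <- iota 0 (size r)]).
- apply/allP => _ /mapP[i _ ->]; rewrite rootE hornerM hornerD hornerN mulf_eq0.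
  by rewrite horner_prodX_eq0; case: (boolP (_ \in s)); rewrite ?orbT // => /hpq ->; rewrite subrr eqxx.
- by rewrite map_inj_uniq ?iota_uniq // => i j /eqP; rewrite eqr_nat => /eqP.
- by rewrite size_map size_iota.
Qed.

(* The weight of an up step followed by a down step. *)
Definition lquad (a b c w : R) := a * w + b + c / w.

Lemma amcm_frac_neq1 h ns e : amcm_frac h ns e -> {in ns, forall v, v != 1}.
Proof.
move=> [_ _ hns _] v /hns[_ h0]; apply: contraTneq h0 => ->.
by rewrite subrr mulr0 ltxx.
Qed.

Lemma amcm_frac_notin h ns e : amcm_frac h ns e -> 0 \notin ns /\ 1 \notin ns.
Proof.
move=> H; split; apply/negP; last by move/(amcm_frac_neq1 H); rewrite eqxx.
by case: H => _ _ hns _ /hns[]; rewrite ltxx.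
Qed.

(* Poles and coefficients of [- q H / (1 - w)], except for the pole at [1]. *)
Definition step_poles c h ns e :=
  if 0 < c * pfrac h ns e 0 then 0 :: ns else ns.

Definition step_coef a b c h ns e l :=
  if l == 0 then c * pfrac h ns e 0 else lquad a b c l * e l / (1 - l).

(** Both sides are linear in [h] and [e], so the identity is checked on the constant and on each
    [e v / (w - v)]. The term [a * w] of the weight, divided by [1 - w], produces the constant
    [a * h]; the term [c / w] produces the pole at [0]. *)
Lemma step_pfrac a b c h ns e w :
  0 <= c -> amcm_frac h ns e -> w != 0 -> w != 1 -> w \notin ns ->
  - (lquad a b c w * pfrac h ns e w) / (1 - w) = a * h
    + \sum_(l <- step_poles c h ns e) step_coef a b c h ns e l / (l - w)
    - lquad a b c 1 * pfrac h ns e 1 / (1 - w).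
Proof.
move=> c0 H w0 w1 wns.
have [ns0 ns1] := amcm_frac_notin H.
have w10 : 1 - w != 0 by rewrite subr_eq0 eq_sym.
have -> : \sum_(l <- step_poles c h ns e) step_coef a b c h ns e l / (l - w) =
    c * pfrac h ns e 0 / (0 - w) +
    \sum_(v <- ns) lquad a b c v * e v / (1 - v) / (v - w).
  have -> : \sum_(v <- ns) lquad a b c v * e v / (1 - v) / (v - w) =
            \sum_(v <- ns) step_coef a b c h ns e v / (v - w).
    rewrite big_seq [RHS]big_seq; apply: eq_bigr => v vns.
    by rewrite /step_coef; case: eqVneq => // v0; rewrite -v0 vns in ns0.
  rewrite /step_poles; case: ifPn => [_|]; first by rewrite big_cons /step_coef eqxx.
  rewrite lt_neqAle negb_and negbK mulr_ge0 ?orbF //; last by case: H.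
  by move/eqP <-; rewrite mul0r add0r.
have -> : a * h + (c * pfrac h ns e 0 / (0 - w) +
    \sum_(v <- ns) lquad a b c v * e v / (1 - v) / (v - w)) -
    lquad a b c 1 * pfrac h ns e 1 / (1 - w) =
    (a * h + c * h / (0 - w) - lquad a b c 1 * h / (1 - w)) +
    \sum_(v <- ns) (c * (e v / (0 - v)) / (0 - w) +
       lquad a b c v * e v / (1 - v) / (v - w) - lquad a b c 1 * (e v / (1 - v)) / (1 - w)).
  rewrite !big_split /= sumrN -!mulr_suml -!mulr_sumr /pfrac.
  by set S0 := \sum_(v <- ns) e v / _; set S1 := \sum_(v <- ns) e v / _;
     set S2 := \sum_(v <- ns) _; ring.
rewrite {1}/pfrac mulrDr opprD mulrDl; congr (_ + _).
  by rewrite /lquad; field; rewrite w0 w10.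
rewrite mulr_sumr -sumrN mulr_suml big_seq [RHS]big_seq; apply: eq_bigr => v vns.
have v0 : v != 0 by apply: contraNneq ns0 => <-.
have v1 : 1 - v != 0 by rewrite subr_eq0; apply: contraNneq ns1 => ->.
have wv : w - v != 0 by rewrite subr_eq0; apply: contraNneq wns => ->.
have vw : v - w != 0 by rewrite -opprB oppr_eq0.
by rewrite /lquad; field; rewrite w0 w10 v0 v1 wv vw.
Qed.

(** As [e v / (1 - v)] has the sign of [e v * (1 - v)] and the weight is positive at [v > 0], the
    sign condition of [amcm_frac] becomes positivity of all coefficients. The pole at [0] is listed
    only when its coefficient is positive. *)
Lemma step_poles_props a b c h ns e :
  0 <= a -> 0 <= b -> 0 <= c -> 0 < a + b + c -> amcm_frac h ns e ->
  let zs := step_poles c h ns e in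
  [/\ uniq zs, 1 \notin zs, {subset ns <= zs} &
      {in zs, forall l, 0 <= l /\ 0 < step_coef a b c h ns e l}].
Proof.
move=> a0 b0 c0 abc H zs; have [ns0 ns1] := amcm_frac_notin H.
have [_ uns hns _] := H.
have hv v : v \in ns -> 0 <= v /\ 0 < step_coef a b c h ns e v.
  move=> vns; have [v0 ev] := hns _ vns; split; first exact: ltW.
  rewrite /step_coef gt_eqF // -mulrA mulr_gt0 //.
    have : 0 < v * (a * v + b) + c.
      have [c00|c00] := eqVneq c 0; last first.
        by rewrite ltr_wpDl ?lt_neqAle 1?eq_sym ?c00 // mulr_ge0 ?addr_ge0 ?mulr_ge0 // ltW.
      rewrite c00 addr0 mulr_gt0 //.
      have [b00|b00] := eqVneq b 0; last first.
        by rewrite ltr_wpDl ?lt_neqAle 1?eq_sym ?b00 // mulr_ge0 // ltW.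
      by move: abc; rewrite c00 b00 !addr0 => a00; rewrite mulr_gt0.
    move=> hv; rewrite (_ : lquad a b c v = (v * (a * v + b) + c) / v) ?divr_gt0 //.
    by rewrite /lquad; field; rewrite gt_eqF.
  have v1 : 1 - v != 0 by rewrite subr_eq0 eq_sym (amcm_frac_neq1 H).
  rewrite (_ : _ / _ = e v * (1 - v) / (1 - v) ^+ 2) ?divr_gt0 ?exprn_even_gt0 //.
  by field.
rewrite /zs /step_poles; case: ifPn => h0; last by split.
split; first by rewrite /= ns0.
- by rewrite inE negb_or oner_eq0.
- by move=> v vns; rewrite inE vns orbT.
- by move=> l; rewrite inE => /orP[/eqP ->|/hv //]; rewrite /step_coef eqxx.
Qed.

Definition quad (a b c : R) : {poly R} := a *: 'X^2 + b *: 'X + c%:P.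

Lemma horner_quad a b c w : w != 0 -> (quad a b c).[w] = w * lquad a b c w.
Proof. by move=> w0; rewrite /quad /lquad !hornerE /=; field. Qed.

(** Numerator and denominator of the continued fraction [H 0 = 0],
    [H (j + 1) = 1 / (1 - (q j / 'X) * H j)]. The denominator is ['X^j] times the determinant of the
    walk on the levels [1, ..., j]. *)
Fixpoint cont_pair (q : nat -> {poly R}) (j : nat) : {poly R} * {poly R} :=
  if j is i.+1 then ('X * (cont_pair q i).2,
                     'X * (cont_pair q i).2 - q i * (cont_pair q i).1)
  else (0, 1).

(** Here [b] says that the fraction vanishes at the relevant end before the step, and [z] that a
    zero is created, after which it vanishes there. The strict bound leaves just enough room for
    this alternation. *)
Let count_step (x j : nat) (b z : bool) :
  (x.*2 < j + b)%N -> (b -> ~~ z) -> ((z + x).*2 < j.+1 + z)%N.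
Proof. by case: b z => [] []; lia. Qed.

(* A zero of [Q] below (above) [1] can be created only when [P / Q] does not
   vanish at [0] (at infinity), and its creation makes [P / Q] vanish there:
   this is why the number of zeros grows at most at every other step. *)
Lemma cont_pair_amcm (a b c : nat -> R) (J : nat) :
  let q i := quad (a i) (b i) (c i) in
  (forall i, (i < J)%N ->
     [/\ 0 <= a i, 0 <= b i, 0 <= c i & 0 < a i + b i + c i]) ->
  (forall i, (i <= J)%N -> 0 < (cont_pair q i).2.[1]) ->
  forall j, (j <= J)%N ->
  exists h ns e k m, [/\ amcm_frac h ns e, k != 0,
    (cont_pair q j).2 = k *: ('X^m * prodX ns),
    forall w, w != 0 -> w \notin ns ->
      (cont_pair q j).1.[w] = (cont_pair q j).2.[w] * pfrac h ns e w &
    [/\ (m + count (< 1%R) ns = j)%N,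
        ((count (< 1%R) ns).*2 < j + (pfrac h ns e 0 == 0)%R)%N &
        ((count (> 1%R) ns).*2 < j + (h == 0)%R)%N]].
Proof.
move=> q hq hQ; elim=> [|j IH] ltjJ.
  exists 0, [::], (fun=> 0), 1, 0%N; split=> //.
  - exact: amcm_frac_nil.
  - by rewrite scale1r expr0 mul1r /prodX big_nil.
  - by move=> w _ _; rewrite /= /pfrac big_nil addr0 mulr0 horner0.
  - by rewrite /= /pfrac big_nil addr0 eqxx.
have [h [ns [e [k [m [H k0 QE PE [mE cl cg]]]]]]] := IH (ltnW ltjJ).
have [a0 b0 c0 abc] := hq _ ltjJ.
have [uz z1 subz hz] := step_poles_props a0 b0 c0 abc H.
set zs := step_poles _ _ _ _ in uz z1 subz hz.
have [ns0 ns1] := amcm_frac_notin H.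
set Q := (cont_pair q j).2 in QE PE; set P := (cont_pair q j).1 in PE.
have Q1E w : w != 0 -> w \notin ns ->
    (cont_pair q j.+1).2.[w] = w * Q.[w] * (1 - lquad (a j) (b j) (c j) w * pfrac h ns e w).
  move=> w0 wns; rewrite /= hornerD hornerN !hornerM hornerX -/Q -/P PE // horner_quad //.
  ring.
(* This will be the coefficient of [1 / (1 - w)] in [amcm_inversion]; it is the ratio of two
   consecutive denominators at [1]. *)
have psi1 : 0 < 1 - lquad (a j) (b j) (c j) 1 * pfrac h ns e 1.
  by have := hQ _ ltjJ; rewrite Q1E ?oner_eq0 // mul1r pmulr_rgt0 // hQ // ltnW.
have A0 : 0 <= a j * h by rewrite mulr_ge0 //; case: H.
have [h' [ns' [e' [k' [H' k'0 [cl' cg' h'0 p'0] RE FE]]]]] :=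
  amcm_inversion uz z1 hz psi1 A0.
pose z := (0 < c j * pfrac h ns e 0).
have zsE : zs = nseq z 0 ++ ns by rewrite /zs /step_poles -/z; case: (z).
have m1 : (z <= m.+1)%N by case: (z).
exists h', ns', e', (k * k'), (m.+1 - z)%N.
(* A pole at [0] in [zs] absorbs one factor ['X], whence the exponent [m.+1 - z]. *)
have Xz w : w ^+ m.+1 * (prodX ns).[w] = w ^+ (m.+1 - z) * (prodX zs).[w].
  have nz : (prodX (nseq z 0)).[w] = w ^+ z.
    by case: (z); rewrite /prodX /= ?big_cons big_nil ?hornerM ?hornerXsubC hornerE ?subr0 ?mulr1.
  by rewrite zsE prodX_cat hornerM nz mulrA -exprD subnK.
have QE' : (cont_pair q j.+1).2 = (k * k') *: ('X^(m.+1 - z) * prodX ns').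
  apply: (@poly_eq_cofinite _ _ (0 :: 1 :: zs)) => w.
  rewrite !inE !negb_or => /and3P[w0 w1 wzs].
  have wns : w \notin ns by apply: contraNN wzs => /subz.
  have w10 : 1 - w != 0 by rewrite subr_eq0 eq_sym.
  rewrite Q1E // QE !(hornerZ, hornerM, hornerXn).
  have -> : w * (k * (w ^+ m * (prodX ns).[w])) = k * (w ^+ m.+1 * (prodX ns).[w]).
    by rewrite exprS; ring.
  rewrite Xz; have := RE w wzs w1.
  have -> : a j * h + (1 - lquad (a j) (b j) (c j) 1 * pfrac h ns e 1) / (1 - w) +
     \sum_(l <- zs) step_coef (a j) (b j) (c j) h ns e l / (l - w) =
     (1 - lquad (a j) (b j) (c j) w * pfrac h ns e w) / (1 - w).
    rewrite !mulrBl -[X in _ = _ + X]mulNr step_pfrac // -/zs; ring.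
  rewrite mulrCA divff // mulr1 => RE'.
  by rewrite -!mulrA; congr (_ * _); rewrite [RHS]mulrCA -RE'; ring.
split=> //.
- by rewrite mulf_neq0.
- move=> w w0 wns'; rewrite QE' /= -/Q QE.
  rewrite !(hornerZ, hornerM, hornerXn, hornerX).
  have -> : w * (k * (w ^+ m * (prodX ns).[w])) = k * (w ^+ m.+1 * (prodX ns).[w]).
    by rewrite exprS; ring.
  rewrite Xz FE //; ring.
have czs : count (< 1%R) zs = (z + count (< 1%R) ns)%N.
  by rewrite zsE count_cat count_nseq /= ltr01 mul1n.
have czg : count (> 1%R) zs = count (> 1%R) ns.
  by rewrite zsE count_cat count_nseq /= ltNge ler01 mul0n.
have z0 : (0 \in zs) = z by rewrite zsE mem_cat (negPf ns0) orbF mem_nseq eqxx andbT; case: (z).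
rewrite cl' cg' h'0 p'0 czs czg z0; split.
- by rewrite addnA subnK // addSn mE.
- by apply: count_step cl _ => /eqP hp; rewrite /z hp mulr0 ltxx.
- by rewrite addnC; apply: count_step cg _ => /eqP ->; rewrite mulr0 ltxx.
Qed.

(** Divided by [1 - w], [psi] is a sum of Stieltjes functions, hence again one. The two sets of
    poles may meet, for instance at [0]; they are merged, the coefficients at common poles are
    added, and [amcm_inversion] applies once more. *)
Lemma amcm_combine h1 ns1 e1 a1 b1 c1 h2 ns2 e2 a2 b2 c2 :
  [/\ 0 <= a1, 0 <= b1, 0 <= c1 & 0 < a1 + b1 + c1] ->
  [/\ 0 <= a2, 0 <= b2, 0 <= c2 & 0 < a2 + b2 + c2] ->
  amcm_frac h1 ns1 e1 -> amcm_frac h2 ns2 e2 ->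
  let psi w := 1 - lquad a1 b1 c1 w * pfrac h1 ns1 e1 w
                 - lquad a2 b2 c2 w * pfrac h2 ns2 e2 w in
  0 < psi 1 ->
  exists h ns e k ls, [/\ amcm_frac h ns e, k != 0,
   {subset ns1 <= ls} /\ {subset ns2 <= ls},
   forall w, w != 0 -> w != 1 -> w \notin ls ->
     psi w * (prodX ls).[w] = k * (prodX ns).[w] &
   forall w, w \notin ns -> (prodX ls).[w] = k * (prodX ns).[w] * pfrac h ns e w].
Proof.
move=> [a10 b10 c10 abc1] [a20 b20 c20 abc2] H1 H2 psi psi1.
have [uz1 z11 subz1 hz1] := step_poles_props a10 b10 c10 abc1 H1.
have [uz2 z21 subz2 hz2] := step_poles_props a20 b20 c20 abc2 H2.
set z1 := step_poles _ _ _ _ in uz1 z11 subz1 hz1.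
set z2 := step_poles _ _ _ _ in uz2 z21 subz2 hz2.
pose c l := (if l \in z1 then step_coef a1 b1 c1 h1 ns1 e1 l else 0) +
            (if l \in z2 then step_coef a2 b2 c2 h2 ns2 e2 l else 0).
pose ls := undup (z1 ++ z2).
have sub1 : {subset z1 <= ls} by move=> l lz; rewrite mem_undup mem_cat lz.
have sub2 : {subset z2 <= ls} by move=> l lz; rewrite mem_undup mem_cat lz orbT.
have ls1 : 1 \notin ls by rewrite mem_undup mem_cat negb_or z11.
have hls : {in ls, forall l, 0 <= l /\ 0 < c l}.
  move=> l; rewrite mem_undup mem_cat /c; case: ifP => [/hz1[l0 cl]|_] /=.
    case: ifP => [/hz2[_ cl2]|_ _]; last by rewrite addr0.
    by rewrite addr_gt0.
  by move=> lz2; rewrite lz2; have [l0 cl] := hz2 _ lz2; rewrite add0r.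
have sumE z f (w : R) : uniq z -> {subset z <= ls} ->
    \sum_(l <- ls) (if l \in z then f l else 0) / (l - w) = \sum_(l <- z) f l / (l - w).
  move=> uz subz.
  transitivity (\sum_(l <- ls | l \in z) f l / (l - w)).
    by rewrite [RHS]big_mkcond; apply: eq_bigr => l _; case: ifP; rewrite ?mul0r.
  rewrite -big_filter; apply/perm_big/uniq_perm; rewrite ?filter_uniq ?undup_uniq // => l.
  by rewrite mem_filter; case: (boolP (l \in z)) => //= /subz.
have A0 : 0 <= a1 * h1 + a2 * h2.
  by rewrite addr_ge0 ?mulr_ge0 //; [case: H1|case: H2].
have [h [ns [e [k [H k0 _ RE FE]]]]] :=
  amcm_inversion (undup_uniq (z1 ++ z2)) ls1 hls psi1 A0.
exists h, ns, e, k, ls; split=> //.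
  by split=> v; [move/subz1/sub1|move/subz2/sub2].
move=> w w0 w1 wls.
have w10 : 1 - w != 0 by rewrite subr_eq0 eq_sym.
have wns1 : w \notin ns1 by apply: contraNN wls => /subz1/sub1.
have wns2 : w \notin ns2 by apply: contraNN wls => /subz2/sub2.
rewrite -RE //; congr (_ * _).
have -> : \sum_(l <- undup (z1 ++ z2)) c l / (l - w) =
    \sum_(l <- z1) step_coef a1 b1 c1 h1 ns1 e1 l / (l - w) +
    \sum_(l <- z2) step_coef a2 b2 c2 h2 ns2 e2 l / (l - w).
  rewrite -(sumE z1) // -(sumE z2) // -big_split.
  by apply: eq_bigr => l _; rewrite /= /c mulrDl.
have := step_pfrac a1 b1 c10 H1 w0 w1 wns1; have := step_pfrac a2 b2 c20 H2 w0 w1 wns2.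
rewrite -/z1 -/z2; set S1 := \sum_(l <- z1) _; set S2 := \sum_(l <- z2) _ => E2 E1.
have -> : S1 = - (lquad a1 b1 c1 w * pfrac h1 ns1 e1 w) / (1 - w) - a1 * h1
               + lquad a1 b1 c1 1 * pfrac h1 ns1 e1 1 / (1 - w) by rewrite E1; ring.
have -> : S2 = - (lquad a2 b2 c2 w * pfrac h2 ns2 e2 w) / (1 - w) - a2 * h2
               + lquad a2 b2 c2 1 * pfrac h2 ns2 e2 1 / (1 - w) by rewrite E2; ring.
by rewrite /psi; field.
Qed.

End Continuants.

(** * Polynomials acting on two-sided sequences *)

Section ShiftAction.
Variable R : comNzRingType.
Implicit Types (p q : {poly R}) (u v : int -> R) (k : int) (c : R).

(* ['X] acts on two-sided sequences as the shift [u k |-> u (k - 1)]. *)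
Definition act p u k : R := \sum_(i < size p) p`_i * u (k - i%:Z).

Lemma act_widen n p u k : (size p <= n)%N ->
  act p u k = \sum_(i < n) p`_i * u (k - i%:Z).
Proof.
move=> sp; rewrite /act (big_ord_widen n (fun i : nat => p`_i * u (k - i%:Z)) sp).
rewrite big_mkcond; apply: eq_bigr => i _; case: ltnP => // pi.
by rewrite nth_default ?mul0r.
Qed.

Lemma actD p q u k : act (p + q) u k = act p u k + act q u k.
Proof.
set n := maxn (size p) (size q).
rewrite !(@act_widen n) ?leq_maxl ?leq_maxr ?size_polyD // -big_split.
by apply: eq_bigr => i _; rewrite coefD mulrDl.
Qed.

Lemma actZ c p u k : act (c *: p) u k = c * act p u k.
Proof.
rewrite (@act_widen (size p)) ?size_scale_leq // mulr_sumr.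
by apply: eq_bigr => i _; rewrite coefZ mulrA.
Qed.

Lemma act0 u k : act 0 u k = 0.
Proof. by rewrite /act size_poly0 big_ord0. Qed.

Lemma actN p u k : act (- p) u k = - act p u k.
Proof. by rewrite -scaleN1r actZ mulN1r. Qed.

Lemma actB p q u k : act (p - q) u k = act p u k - act q u k.
Proof. by rewrite actD actN. Qed.

Lemma act1 u k : act 1 u k = u k.
Proof. by rewrite /act size_poly1 big_ord1 coef1 mul1r subr0. Qed.

Lemma actC c u k : act c%:P u k = c * u k.
Proof. by rewrite -[c%:P]mulr1 mul_polyC actZ act1. Qed.

Lemma actXM p u k : act ('X * p) u k = act p u (k - 1).
Proof.
rewrite (@act_widen (size p).+1) /act; last first.
  by rewrite mulrC (leq_trans (size_polyMleq _ _)) // size_polyX addnC.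
rewrite big_ord_recl coefXM mul0r add0r; apply: eq_bigr => i _.
by rewrite coefXM /= /bump /= add1n; congr (_ * u _); lia.
Qed.

Lemma actX u k : act 'X u k = u (k - 1).
Proof. by rewrite -['X]mulr1 actXM act1. Qed.

Lemma actM p q u k : act (p * q) u k = act p (act q u) k.
Proof.
elim/poly_ind: p k => [|p c IH] k; first by rewrite mul0r !act0.
rewrite mulrDl !actD mul_polyC actZ actC; congr (_ + _).
by rewrite [p * 'X]mulrC -mulrA !actXM IH.
Qed.

Lemma act_sum (I : Type) (s : seq I) (P : I -> {poly R}) u k :
  act (\sum_(i <- s) P i) u k = \sum_(i <- s) act (P i) u k.
Proof.
by elim: s => [|i s IH]; rewrite ?big_nil ?act0 // !big_cons actD IH.
Qed.

Lemma act_sumr (I : Type) (s : seq I) p (a : I -> R) (w : I -> int -> R) k :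
  act p (fun j => \sum_(i <- s) a i * w i j) k = \sum_(i <- s) a i * act p (w i) k.
Proof.
rewrite /act; under [RHS]eq_bigr do rewrite mulr_sumr.
rewrite exchange_big; apply: eq_bigr => i _; rewrite mulr_sumr.
by apply: eq_bigr => j _; rewrite mulrCA.
Qed.

Lemma act_linear p c u v k :
  act p (fun j => c * u j + v j) k = c * act p u k + act p v k.
Proof.
rewrite /act mulr_sumr -big_split; apply: eq_bigr => i _ /=.
by rewrite mulrDr mulrCA.
Qed.

Lemma act_sub p u v k : act p (fun j => u j - v j) k = act p u k - act p v k.
Proof.
by rewrite /act -sumrB; apply: eq_bigr => i _; rewrite mulrBr.
Qed.

Lemma act_shift p u s k : act p (fun j => u (j + s)) k = act p u (k + s).
Proof. by apply: eq_bigr => i _; rewrite addrAC. Qed.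

Lemma eq_act p u v k : u =1 v -> act p u k = act p v k.
Proof. by move=> uv; apply: eq_bigr => i _; rewrite uv. Qed.

Lemma actXn n u k : act 'X^n u k = u (k - n%:Z).
Proof.
elim: n k => [|n IH] k; first by rewrite expr0 act1 subr0.
by rewrite exprS actXM IH; congr u; lia.
Qed.

End ShiftAction.

(** * Cancellation on bounded sequences *)

Section BoundedSequences.
Variable R : realType.
Implicit Types (p q : {poly R}) (u v : int -> R) (k : int) (c w : R).

Definition bounded_seq u := exists M, forall k, `|u k| <= M.

Lemma bounded_act p u : bounded_seq u -> bounded_seq (act p u).
Proof.
move=> [M uM]; exists (\sum_(i < size p) `|p`_i| * M) => k.
apply: (le_trans (ler_norm_sum _ _ _)); apply: ler_sum => i _.
by rewrite normrM ler_wpM2l.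
Qed.

Lemma bounded_sub u v : bounded_seq u -> bounded_seq v ->
  bounded_seq (fun k => u k - v k).
Proof.
move=> [M uM] [M' vM]; exists (M + M') => k.
by rewrite (le_trans (ler_normB _ _)) // lerD.
Qed.

Lemma bounded_shift u s : bounded_seq u -> bounded_seq (fun k => u (k + s)).
Proof. by move=> [M uM]; exists M. Qed.

Lemma le_cvg (u v : nat -> R) a b : (forall n, u n <= v n) ->
  u n @[n --> \oo] --> a -> v n @[n --> \oo] --> b -> a <= b.
Proof.
move=> uv hu hv; rewrite -(cvg_lim _ hu) // -(cvg_lim _ hv) //.
by apply: ler_lim; [exact: cvgP hu|exact: cvgP hv|exact: nearW].
Qed.

Lemma le_geometric_eq0 (x M r : R) : 0 <= r < 1 ->
  (forall n : nat, `|x| <= M * r ^+ n) -> x = 0.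
Proof.
move=> /andP[r0 r1] hx; apply/eqP; rewrite -normr_le0.
have h : (M * r ^+ n) @[n --> \oo] --> (0 : R).
  rewrite -[X in _ --> X](mulr0 M); apply: cvgM; first exact: cvg_cst.
  by apply: cvg_expr; rewrite ger0_norm.
by apply: le_cvg hx _ h; exact: cvg_cst.
Qed.

(** Injectivity on bounded sequences: this takes the place of division by [p]. *)
Definition regular p := forall u, bounded_seq u ->
  (forall k, act p u k = 0) -> forall k, u k = 0.

Lemma regularM p q : regular p -> regular q -> regular (p * q).
Proof.
move=> rp rq u bu h; apply: rq => //; apply: rp; first exact: bounded_act.
by move=> k; rewrite -actM.
Qed.

Lemma regularX : regular 'X.
Proof. by move=> u _ h k; have := h (k + 1); rewrite actX addrK. Qed.

Lemma regular1 : regular 1.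
Proof. by move=> u _ h k; rewrite -(act1 u) h. Qed.

Lemma regularXn n : regular 'X^n.
Proof.
elim: n => [|n IH]; first by rewrite expr0; exact: regular1.
by rewrite exprS; apply: regularM => //; exact: regularX.
Qed.

Lemma regularZ c p : c != 0 -> regular p -> regular (c *: p).
Proof.
move=> c0 rp u bu h; apply: rp => // k.
by apply: (mulfI c0); rewrite -actZ h mulr0.
Qed.

(** A sequence killed by ['X - w] is geometric, so it is unbounded in one direction unless it
    vanishes. At [w = 1] the constants would survive. *)
Lemma regularXsubC w : 0 < w -> w != 1 -> regular ('X - w%:P).
Proof.
move=> w0 w1 u [M uM] h.
have {}h k : u (k - 1) = w * u k.
  by have /eqP := h k; rewrite actB actX actC subr_eq0 => /eqP.
have [w_lt1|w_gt1|/eqP] := ltgtP w 1; last by rewrite (negPf w1).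
  have hn n k : u k = w ^+ n * u (k + n%:Z).
    elim: n k => [|n IH] k; first by rewrite expr0 mul1r addr0.
    by rewrite exprSr -mulrA -h IH; congr (_ * u _); lia.
  move=> k; apply: (@le_geometric_eq0 _ M w); first by rewrite ltW.
  by move=> n; rewrite (hn n) normrM normrX gtr0_norm // mulrC ler_wpM2r // exprn_ge0 // ltW.
have {}h k : u k = w^-1 * u (k - 1) by rewrite h mulKf ?gt_eqF.
have hn n k : u k = w^-1 ^+ n * u (k - n%:Z).
  elim: n k => [|n IH] k; first by rewrite expr0 mul1r subr0.
  by rewrite exprSr -mulrA IH [u (k - n%:Z)]h; congr (_ * (_ * u _)); lia.
move=> k; apply: (@le_geometric_eq0 _ M w^-1).
  by rewrite invr_ge0 ltW ?invf_lt1.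
move=> n; rewrite (hn n) normrM normrX gtr0_norm ?invr_gt0 // mulrC ler_wpM2r //.
by rewrite exprn_ge0 // invr_ge0 ltW.
Qed.

Lemma regular_prodX (s : seq R) : {in s, forall w, 0 < w /\ w != 1} -> regular (prodX s).
Proof.
elim: s => [|w s IH] hs; first by rewrite /prodX big_nil; exact: regular1.
rewrite prodX_cons; apply: regularM.
  by have [w0 w1] := hs w (mem_head _ _); apply: regularXsubC.
by apply: IH => x xs; apply: hs; rewrite in_cons xs orbT.
Qed.

End BoundedSequences.

(** * Complete monotonicity of sums of powers and of limits *)

Section CompletelyMonotone.
Variable R : realType.
Implicit Types (c : nat -> R) (x : R).

Lemma iter_fdiffD n c1 c2 k :
  iter n (@fdiff R nat) (fun k => c1 k + c2 k) k =
  iter n (@fdiff R nat) c1 k + iter n (@fdiff R nat) c2 k.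
Proof. by elim: n k => //= n IH k; rewrite /fdiff !IH; ring. Qed.

Lemma iter_fdiffZ n x c k :
  iter n (@fdiff R nat) (fun k => x * c k) k = x * iter n (@fdiff R nat) c k.
Proof. by elim: n k => //= n IH k; rewrite /fdiff !IH mulrBr. Qed.

Lemma iter_fdiff_expr n x k :
  iter n (@fdiff R nat) (fun k => x ^+ k) k = (x - 1) ^+ n * x ^+ k.
Proof.
elim: n k => [|n IH] k /=; first by rewrite expr0 mul1r.
by rewrite /fdiff !IH [(k + 1)%R]addn1 exprS [in RHS]exprS; ring.
Qed.

Lemma completely_monotone_expr x : 0 <= x <= 1 ->
  completely_monotone (fun k => x ^+ k).
Proof.
move=> /andP[x0 x1] n k; rewrite iter_fdiff_expr mulrA -exprMn.
by rewrite mulr_ge0 ?exprn_ge0 // mulN1r opprB subr_ge0.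
Qed.

Lemma completely_monotoneD c1 c2 : completely_monotone c1 ->
  completely_monotone c2 -> completely_monotone (fun k => c1 k + c2 k).
Proof. by move=> h1 h2 n k; rewrite iter_fdiffD mulrDr addr_ge0. Qed.

Lemma completely_monotoneZ x c : 0 <= x -> completely_monotone c ->
  completely_monotone (fun k => x * c k).
Proof. by move=> x0 h n k; rewrite iter_fdiffZ mulrCA mulr_ge0. Qed.

Lemma completely_monotone_sum (s : seq R) (a r : R -> R) :
  {in s, forall v, 0 <= a v /\ 0 <= r v <= 1} ->
  completely_monotone (fun k => \sum_(v <- s) a v * r v ^+ k).
Proof.
elim: s => [|v s IH] hs.
  have -> : (fun k => \sum_(v <- [::]) a v * r v ^+ k) = (fun k : nat => 0 * 1 ^+ k).
    by apply/funext => k; rewrite big_nil mul0r.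
  by apply/completely_monotoneZ/completely_monotone_expr; rewrite // ler01 lexx.
have -> : (fun k => \sum_(v <- v :: s) a v * r v ^+ k) =
    (fun k : nat => a v * r v ^+ k + \sum_(v <- s) a v * r v ^+ k).
  by apply/funext => k; rewrite big_cons.
have [av rv] := hs v (mem_head _ _); apply: completely_monotoneD.
  by apply/completely_monotoneZ/completely_monotone_expr.
by apply: IH => x xs; apply: hs; rewrite in_cons xs orbT.
Qed.

Lemma completely_monotone_cvg (C : nat -> nat -> R) c :
  (forall N, completely_monotone (C N)) -> (forall k, C N k @[N --> \oo] --> c k) ->
  completely_monotone c.
Proof.
move=> hC hc n k.
have hn : iter n (@fdiff R nat) (C N) k @[N --> \oo] --> iter n (@fdiff R nat) c k.
  elim: n k => [|n IH] k /=; first exact: hc.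
  by rewrite /fdiff; apply: cvgB; apply: IH.
apply: (@le_cvg _ (fun=> 0) (fun N => (-1) ^+ n * iter n (@fdiff R nat) (C N) k)).
- by move=> N; apply: hC.
- exact: cvg_cst.
- by apply: cvgM => //; exact: cvg_cst.
Qed.

End CompletelyMonotone.

(** * Bounded sequences with rational generating functions *)

Section ExplicitSolution.
Variable R : realType.
Implicit Types (p : {poly R}) (u g : int -> R) (k : int) (h w : R) (ns : seq R) (e : R -> R).

(* The bounded sequence whose generating function is [1 / (z - w)]: it is
   supported on negative or nonnegative indices according to whether [w < 1]. *)
Definition pole_seq w k : R :=
  if w < 1 then (if k < 0 then w ^+ `|k|.-1 else 0)
  else (if k < 0 then 0 else - (w^-1) ^+ `|k|.+1).

Lemma act_pole_seq w k : 0 < w -> act ('X - w%:P) (pole_seq w) k = delta0 R k.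
Proof.
move=> w0; rewrite actB actX actC /pole_seq /delta0.
have [k0|k0|->] := ltgtP k 0; last first.
- by case: ifP => _ /=; rewrite ?mulr0 ?subr0 //= expr1 mulrN opprK add0r mulfV ?gt_eqF.
- have -> : (k - 1 < 0) = false by lia.
  case: ifP => _; first by rewrite mulr0 subr0.
  have -> : `|k|%N = `|k - 1|.+1%N by lia.
  by rewrite [in X in _ - X]exprS mulrN mulrA mulfV ?gt_eqF // mul1r subrr.
- have -> : (k - 1 < 0) = true by lia.
  case: ifP => _; last by rewrite mulr0 subr0.
  have -> : `|k - 1|.-1%N = `|k|.-1.+1%N by lia.
  by rewrite exprS subrr.
Qed.

Lemma bounded_pole_seq w : 0 < w -> bounded_seq (pole_seq w).
Proof.
move=> w0; exists 1 => k; rewrite /pole_seq; case: ltP => w1; case: ifP => _;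
  rewrite ?normr0 ?ler01 // ?normrN normrX ?normfV gtr0_norm //.
  by rewrite exprn_ile1 // ltW.
by apply: exprn_ile1; rewrite ?invr_ge0 ?invf_le1 ?(ltW w0).
Qed.

Definition frac_seq h ns e k : R := h * delta0 R k + \sum_(v <- ns) e v * pole_seq v k.

Lemma act_frac_seq h ns e k : uniq ns -> {in ns, forall v, 0 < v} ->
  act (prodX ns) (frac_seq h ns e) k = act (pfrac_num h ns e) (delta0 R) k.
Proof.
move=> uns hns; rewrite /frac_seq act_linear /pfrac_num actD actZ act_sumr act_sum.
congr (_ + _); rewrite big_seq [RHS]big_seq; apply: eq_bigr => v vns.
rewrite actZ (prodX_rem vns) [_ * prodX (rem v ns)]mulrC actM; congr (_ * _); apply: eq_act => i.
by rewrite act_pole_seq // hns.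
Qed.

Lemma bounded_frac_seq h ns e : {in ns, forall v, 0 < v} -> bounded_seq (frac_seq h ns e).
Proof.
move=> hns; rewrite /frac_seq; elim: ns hns => [|v ns IH] hns.
  exists `|h| => k; rewrite big_nil addr0 normrM /delta0.
  by case: (k == 0); rewrite ?normr1 ?normr0 ?mulr1 ?mulr0.
have [M hM] : bounded_seq (frac_seq h ns e).
  by apply: IH => w ws; apply: hns; rewrite in_cons ws orbT.
have [N hN] := bounded_pole_seq (hns v (mem_head _ _)).
exists (`|e v| * N + M) => k; rewrite big_cons addrCA (le_trans (ler_normD _ _)) //.
by rewrite lerD ?hM // normrM ler_wpM2l.
Qed.

(** On either half-line the sequence is a nonnegative combination of powers with ratios in [[0, 1]],
    with [0 ^+ k] correcting the value at the origin. The correction is [h] on the right and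
    [pfrac h ns e 0] on the left, which is why [amcm_frac] prescribes the sign of both. *)
Lemma AM_CM_frac_seq h ns e : amcm_frac h ns e -> (exists k, frac_seq h ns e k != 0) ->
  AM_CM (frac_seq h ns e).
Proof.
move=> [h0 uns hns H0] nz.
have cmp : completely_monotone (fun k : nat => frac_seq h ns e k%:Z).
  have -> : (fun k : nat => frac_seq h ns e k%:Z) = (fun k : nat =>
      h * 0 ^+ k + \sum_(v <- ns) (if v < 1 then 0 else - e v / v) * (if v < 1 then 0 else v^-1) ^+ k).
    apply/funext => k; rewrite /frac_seq /delta0 expr0n; congr (_ + _).
    apply: eq_bigr => v _; rewrite /pole_seq (_ : (k%:Z < 0) = false) //=.
    by case: ifP => _; rewrite ?mulr0 ?mul0r // exprS mulrN mulrA !mulNr.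
  apply: completely_monotoneD.
    by apply/completely_monotoneZ/completely_monotone_expr; rewrite // lexx ler01.
  apply: completely_monotone_sum => v /hns[v0 ev].
  have [v1|v1] := ltP v 1; first by rewrite lexx ler01.
  split; last by rewrite invr_ge0 (ltW v0) invf_le1.
  rewrite divr_ge0 ?(ltW v0) // oppr_ge0.
  rewrite leNgt; apply/negP => e0; move: ev; rewrite pmulr_rgt0 // subr_gt0.
  by rewrite ltNge v1.
have cmn : completely_monotone (fun k : nat => frac_seq h ns e (- k%:Z)).
  have -> : (fun k : nat => frac_seq h ns e (- k%:Z)) = (fun k : nat =>
      pfrac h ns e 0 * 0 ^+ k + \sum_(v <- ns) (if v < 1 then e v / v else 0) * (if v < 1 then v else 0) ^+ k).
    apply/funext => -[|k]; rewrite /frac_seq /delta0 /pfrac.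
      rewrite !mulr1 -addrA -big_split; congr (_ + _); rewrite big_seq [RHS]big_seq.
      apply: eq_bigr => v /hns[v0 _]; rewrite /pole_seq /= expr1 mulr1 sub0r invrN mulrN.
      by case: ifP => _; rewrite ?mulr0 ?addNr // addr0 mulrN.
    rewrite expr0n mulr0 mulr0 !add0r big_seq [RHS]big_seq.
    apply: eq_bigr => v /hns[v0 _]; rewrite /pole_seq.
    by case: ifP => _; rewrite ?mul0r ?mulr0 //= exprS mulrA divfK ?gt_eqF.
  apply: completely_monotoneD.
    by apply/completely_monotoneZ/completely_monotone_expr; rewrite // lexx ler01.
  apply: completely_monotone_sum => v /hns[v0 ev].
  have [v1|v1] := ltP v 1; last by rewrite lexx ?ler01.
  split; last by rewrite (ltW v0) (ltW v1).
  rewrite divr_ge0 ?(ltW v0) //; apply: ltW.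
  by rewrite -(pmulr_lgt0 _ (_ : 0 < 1 - v)) // subr_gt0.
split=> // k; case: k => k.
  by have := cmp 0%N k; rewrite expr0 mul1r.
by have := cmn 0%N k.+1; rewrite expr0 mul1r NegzE.
Qed.

(* [r] is a common factor that need not be cancelled explicitly. *)
Lemma AM_CM_of_fraction g h ns e r : amcm_frac h ns e -> regular r ->
  bounded_seq g -> (exists k, g k != 0) ->
  (forall k, act (r * prodX ns) g k = act (r * pfrac_num h ns e) (delta0 R) k) ->
  AM_CM g.
Proof.
move=> H hr bg nz hg; have [_ uns hns _] := H.
have ns0 : {in ns, forall v, 0 < v} by move=> v /hns[].
suff gE : g = frac_seq h ns e by rewrite gE; apply: AM_CM_frac_seq => //; rewrite -gE.
have hrp : regular (r * prodX ns).
  apply: regularM => //; apply: regular_prodX => v vns.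
  by rewrite ns0 // (amcm_frac_neq1 H).
apply/funext => k; apply/eqP; rewrite -subr_eq0; apply/eqP; move: k.
apply: hrp => [|k]; first by apply: bounded_sub => //; exact: bounded_frac_seq.
rewrite act_sub hg !actM -act_sub; under eq_act do rewrite act_frac_seq // subrr.
by rewrite /act big1 // => i _; rewrite mulr0.
Qed.

End ExplicitSolution.

(** * The Green function of the killed walk *)

(** Let [D j] be the value of [Q j - x j * P j] at [1]. Since [x + y = 1], the recursion gives
    [D (j + 1) = y (j + 1) * D j], so positivity propagates from [D 0 = 1]. *)
Lemma cont_pair_gt0 (R : rcfType) (q : nat -> {poly R}) (x y : nat -> R) (J : nat) :
  (forall i, (i <= J)%N -> [/\ x i + y i = 1, 0 <= x i & 0 < y i]) ->
  (forall i, (i < J)%N -> (q i).[1] = x i * y i.+1) ->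
  forall j, (j <= J)%N ->
    0 < (cont_pair q j).2.[1] /\
    x j * (cont_pair q j).1.[1] < (cont_pair q j).2.[1].
Proof.
move=> hxy hq; elim=> [|j IH] hj; first by rewrite /= horner0 mulr0 hornerE ltr01.
have [Q0 xPQ] := IH (ltnW hj).
have [xy1 x0 y1] := hxy _ hj.
have PE : (cont_pair q j.+1).1.[1] = (cont_pair q j).2.[1].
  by rewrite /= hornerM hornerX mul1r.
have E : x j.+1 * (cont_pair q j.+1).1.[1] < (cont_pair q j.+1).2.[1].
  rewrite PE /= hornerD hornerN !hornerM hornerX mul1r hq //.
  have := xPQ; rewrite -(ltr_pM2l y1) -subr_gt0 => hlt.
  rewrite -subr_gt0; congr (0 < _): hlt.
  by rewrite (_ : x j.+1 = 1 - y j.+1); [ring | rewrite -xy1; ring].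
by split=> //; apply: le_lt_trans E; rewrite PE mulr_ge0 // ltW.
Qed.

(** * Elimination in the three-term equations for the Green function *)

Section GreenEquations.
Variables (R : realType) (al be ga de : nat -> R) (l N : nat).
Hypothesis lN : (0 < l <= N)%N.
Hypothesis al0 : forall i, 0 <= al i.
Hypothesis be0 : forall i, 0 <= be i.
Hypothesis ga0 : forall i, 0 <= ga i.
Hypothesis de0 : forall i, 0 <= de i.
Hypothesis up0 : forall i, 0 < al i + be i.
Hypothesis dn0 : forall i, 0 < ga i + de i.
Hypothesis sum1 : forall i, al i + be i + (ga i + de i) = 1.

Definition up_poly i : {poly R} := al i *: 'X + (be i)%:P.
(** The weight [de + ga / w] of a down step, multiplied by [w]; this is why the other terms of the
    Green equations carry an extra ['X]. *)
Definition down_poly i : {poly R} := (ga i)%:P + de i *: 'X.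

Definition qa i := al i * de i.+1.
Definition qb i := al i * ga i.+1 + be i * de i.+1.
Definition qc i := be i * ga i.+1.
Definition cross_poly i := quad (qa i) (qb i) (qc i).

Lemma cross_polyE i : cross_poly i = up_poly i * down_poly i.+1.
Proof.
rewrite /cross_poly /quad /up_poly /down_poly /qa /qb /qc -!mul_polyC !polyCD !polyCM; ring.
Qed.

Lemma horner1_up_poly i : (up_poly i).[1] = al i + be i.
Proof. by rewrite /up_poly !hornerE. Qed.

Lemma horner1_down_poly i : (down_poly i).[1] = ga i + de i.
Proof. by rewrite /down_poly !hornerE. Qed.

Lemma cross_poly_props i :
  [/\ 0 <= qa i, 0 <= qb i, 0 <= qc i & 0 < qa i + qb i + qc i].
Proof.
rewrite /qa /qb /qc; split; rewrite ?addr_ge0 ?mulr_ge0 //.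
by have := mulr_gt0 (up0 i) (dn0 i.+1); congr (0 < _); ring.
Qed.

Section Solution.
Variable G : nat -> int -> R.
Hypothesis G0 : forall k, G 0 k = 0.
Hypothesis GE : forall i k, (i < N)%N -> act 'X (G i.+1) k =
  (i.+1 == l)%:R * act 'X (delta0 R) k + act ('X * up_poly i) (G i) k
  + act (down_poly i.+2) (G i.+2) k.

Lemma act_eq_mul r p q u v : (forall k, act p u k = act q v k) ->
  forall k, act (r * p) u k = act (r * q) v k :> R.
Proof. by move=> h k; rewrite !actM; apply: eq_act. Qed.

Lemma GEM r i k : (i < N)%N -> act (r * 'X) (G i.+1) k =
  (i.+1 == l)%:R * act (r * 'X) (delta0 R) k + act (r * ('X * up_poly i)) (G i) k
  + act (r * down_poly i.+2) (G i.+2) k.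
Proof.
move=> iN; rewrite !(actM r).
transitivity (act r (fun k => (i.+1 == l)%:R * act 'X (delta0 R) k + (1 * act ('X * up_poly i) (G i) k
  + act (down_poly i.+2) (G i.+2) k)) k).
  by apply: eq_act => j; rewrite GE // mul1r addrA.
by rewrite !act_linear mul1r addrA.
Qed.

Definition Qs j := (cont_pair cross_poly j).2.
Definition Ps j := (cont_pair cross_poly j).1.

Lemma PsS j : Ps j.+1 = 'X * Qs j. Proof. by []. Qed.
Lemma QsS j : Qs j.+1 = 'X * Qs j - up_poly j * down_poly j.+1 * Ps j.
Proof. by rewrite /Qs /= cross_polyE. Qed.

(** Elimination upwards from the killed level: there is no source below [l], so [G j] is obtained
    from [G (j + 1)] through the weight of the down step and the continued fraction
    [Ps j / Qs j]. *)
Lemma green_below j : (j < l)%N -> forall k,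
  act ('X * Qs j) (G j) k = act (Ps j * down_poly j.+1) (G j.+1) k.
Proof.
have [_ lN'] := andP lN.
elim: j => [|j IH] jl k.
  by rewrite mul0r act0 /act big1 // => i _; rewrite G0 mulr0.
have jN : (j < N)%N by apply: leq_trans lN'; exact: ltnW.
have -> : 'X * Qs j.+1 = 'X * Qs j * 'X - 'X * up_poly j * (Ps j * down_poly j.+1).
  by rewrite QsS; ring.
rewrite actB GEM // (ltn_eqF jl) mul0r add0r.
rewrite -(act_eq_mul ('X * up_poly j) (IH (ltnW jl))).
rewrite (_ : 'X * up_poly j * ('X * Qs j) = 'X * Qs j * ('X * up_poly j)); last by ring.
by rewrite addrAC subrr add0r.
Qed.

(** Relates level [1], from which absorption takes place, to the starting level; [Qs l.-1] is the
    determinant [K] up to a power of ['X]. The second identity is the first one a level lower,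
    multiplied by ['X * down_poly j.+1]: the three-term recurrence needs both. *)
Lemma green_first j : (j < l)%N -> forall k,
  act (Qs j) (G 1) k = act (\prod_(i < j) down_poly i.+2) (G j.+1) k /\
  act (down_poly j.+1 * Ps j) (G 1) k = act ('X * \prod_(i < j) down_poly i.+2) (G j) k.
Proof.
have [_ lN'] := andP lN.
elim: j => [|j IH] jl k.
  rewrite !big_ord0 mulr0 mulr1 act0; split=> //.
  by rewrite actX G0.
have jN : (j < N)%N by apply: leq_trans lN'; exact: ltnW.
set D := \prod_(i < j) down_poly i.+2 in IH *.
have IH1 k' := (IH (ltnW jl) k').1; have IH2 k' := (IH (ltnW jl) k').2.
rewrite big_ord_recr /= -/D; split.
  rewrite QsS (_ : _ - _ = 'X * Qs j - up_poly j * (down_poly j.+1 * Ps j)); last by ring.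
  rewrite actB (act_eq_mul _ IH1) (act_eq_mul _ IH2).
  rewrite ['X * D]mulrC GEM // (ltn_eqF jl) mul0r add0r.
  rewrite (_ : up_poly j * (D * 'X) = D * ('X * up_poly j)); last by ring.
  by rewrite addrAC subrr add0r.
rewrite PsS (_ : _ * _ = down_poly j.+2 * 'X * Qs j); last by ring.
rewrite (act_eq_mul _ IH1); congr (act _ _ _); ring.
Qed.

Hypothesis GN : forall k, G N.+1 k = 0.

Definition cross_poly_rev i := cross_poly (N - i).
Definition Qr j := (cont_pair cross_poly_rev j).2.
Definition Pr j := (cont_pair cross_poly_rev j).1.

Lemma PrS j : Pr j.+1 = 'X * Qr j. Proof. by []. Qed.
Lemma QrS j : Qr j.+1 = 'X * Qr j - up_poly (N - j) * down_poly (N - j).+1 * Pr j.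
Proof. by rewrite /Qr /= /cross_poly_rev cross_polyE. Qed.

(** The mirror image of [green_below]: elimination downwards from level [N + 1], where [G] vanishes,
    with no source above [l]. *)
Lemma green_above i : (i + l <= N)%N -> forall k,
  act (Qr i) (G (N - i).+1) k = act (Pr i * up_poly (N - i)) (G (N - i)) k.
Proof.
elim: i => [|i IH] il k.
  by rewrite mul0r act0 subn0 /act big1 // => j _; rewrite GN mulr0.
have il' : (i + l <= N)%N by lia.
have := IH il'; have := QrS i; have : (N - i = (N - i.+1).+1)%N by lia.
have : (N - i.+1 < N)%N by lia.
have : ((N - i.+1).+1 == l) = false by lia.
move: (N - i.+1)%N => m nl mN -> QE {}IH.
have -> : Qr i.+1 = Qr i * 'X - down_poly m.+2 * (Pr i * up_poly m.+1) by rewrite QE; ring.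
rewrite actB -(act_eq_mul (down_poly m.+2) IH) GEM // nl mul0r add0r.
by rewrite [down_poly _ * _]mulrC addrK PrS; congr (act _ _ _); ring.
Qed.

(* [1 / G_l = 1 - q_(l-1) H - q_l H'] with [H], [H'] the continued fractions
   below and above the starting level. *)
Lemma green_diag k :
  let Q := Qs l.-1 in let Q' := Qr (N - l) in
  act ('X * Q * Q' - up_poly l.-1 * down_poly l * (Ps l.-1 * Q') - up_poly l * down_poly l.+1 * (Q * Pr (N - l)))
    (G l) k = act (Q * Q' * 'X) (delta0 R) k.
Proof.
move=> Q Q'; have [l0 lN'] := andP lN.
have ll : (l.-1.+1 = l)%N by rewrite prednK.
have lN1 : (l.-1 < N)%N by rewrite ll.
have := GEM (Q * Q') k lN1; rewrite ll eqxx mul1r => E.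
have lo : (l.-1 < l)%N by rewrite ll.
have := green_below lo; rewrite -/Q ll => Ebelow.
have hi : (N - l + l <= N)%N by rewrite subnK.
have := green_above hi; rewrite -/Q' subKn // => Eabove.
rewrite !actB (_ : 'X * Q * Q' = Q * Q' * 'X); last by ring.
rewrite E.
rewrite (_ : Q * Q' * ('X * up_poly l.-1) = Q' * up_poly l.-1 * ('X * Q)); last by ring.
rewrite (act_eq_mul _ Ebelow).
rewrite (_ : Q * Q' * down_poly l.+1 = Q * down_poly l.+1 * Q'); last by ring.
rewrite (act_eq_mul _ Eabove).
rewrite (_ : Q' * up_poly l.-1 * (Ps l.-1 * down_poly l) = up_poly l.-1 * down_poly l * (Ps l.-1 * Q')); last by ring.
rewrite (_ : Q * down_poly l.+1 * (Pr (N - l) * up_poly l) = up_poly l * down_poly l.+1 * (Q * Pr (N - l))); last by ring.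
by ring.
Qed.

Lemma horner1_cross_poly i : (cross_poly i).[1] = (al i + be i) * (ga i.+1 + de i.+1).
Proof. by rewrite cross_polyE hornerM horner1_up_poly horner1_down_poly. Qed.

Lemma Qs_gt0 j : 0 < (Qs j).[1] /\ (al j + be j) * (Ps j).[1] < (Qs j).[1].
Proof.
apply: (@cont_pair_gt0 _ _ (fun i => al i + be i) (fun i => ga i + de i) j) => //.
  by move=> i _; split; rewrite ?addr_ge0.
by move=> i _; rewrite horner1_cross_poly.
Qed.

Lemma Qr_gt0 j : (j <= N)%N ->
  0 < (Qr j).[1] /\ (ga (N - j).+1 + de (N - j).+1) * (Pr j).[1] < (Qr j).[1].
Proof.
move=> jN.
apply: (@cont_pair_gt0 _ _ (fun i => ga (N - i).+1 + de (N - i).+1)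
          (fun i => al (N - i).+1 + be (N - i).+1) j) => //.
  by move=> i _; split; rewrite ?addr_ge0 // addrC.
move=> i ij; have iN : (i < N)%N by apply: leq_trans jN.
by rewrite /cross_poly_rev horner1_cross_poly subnSK // mulrC.
Qed.

Lemma amcm_frac_cont j : exists h ns e k m, [/\ amcm_frac h ns e, k != 0,
    Qs j = k *: ('X^m * prodX ns),
    forall w, w != 0 -> w \notin ns -> (Ps j).[w] = (Qs j).[w] * pfrac h ns e w &
    [/\ (m + count (< 1%R) ns = j)%N,
        ((count (< 1%R) ns).*2 < j + (pfrac h ns e 0 == 0)%R)%N &
        ((count (> 1%R) ns).*2 < j + (h == 0)%R)%N]].
Proof.
apply: (@cont_pair_amcm _ qa qb qc j) => // i _; first exact: cross_poly_props.
by have [] := Qs_gt0 i.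
Qed.

Lemma AM_CM_green_diag : bounded_seq (G l) -> (exists k, G l k != 0) -> AM_CM (G l).
Proof.
move=> bG nzG; have [l0 lN'] := andP lN.
have [h1 [n1 [e1 [k1 [m1 [H1 k10 QE1 PE1 _]]]]]] := amcm_frac_cont l.-1.
have := @cont_pair_amcm _ (fun i => qa (N - i)) (fun i => qb (N - i)) (fun i => qc (N - i))
  (N - l)%N _ _ (N - l)%N (leqnn _).
case=> [i _|i il|h2 [n2 [e2 [k2 [m2 [H2 k20 QE2 PE2 _]]]]]]; first exact: cross_poly_props.
  by have [] := @Qr_gt0 i; first by lia.
rewrite -/(Qr (N - l)) in QE2 PE2; rewrite -/(Pr (N - l)) in PE2.
have [n10 n11] := amcm_frac_notin H1; have [n20 n21] := amcm_frac_notin H2.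
have q1 := cross_poly_props l.-1; have q2 := cross_poly_props l.
have [Q1 PQ1] := Qs_gt0 l.-1; have [|Q2 PQ2] := @Qr_gt0 (N - l); first by lia.
have lq i w : w != 0 -> (cross_poly i).[w] = w * lquad (qa i) (qb i) (qc i) w.
  exact: horner_quad.
have [|h [ns [e [k [ls [H k0 [sub1 sub2] RE FE]]]]]] := amcm_combine q1 q2 H1 H2.
  have := lq l.-1 1; have := lq l 1; rewrite !horner1_cross_poly !mul1r.
  move=> /(_ (oner_neq0 _)) <- /(_ (oner_neq0 _)) <-; rewrite prednK // => {lq}.
  have p1 := PE1 1 (oner_neq0 _) n11; have p2 := PE2 1 (oner_neq0 _) n21.
  (* The two bounds are weighted by the probabilities [ga l + de l] and [al l + be l] of stepping
     down and up from [l]. As these add up to [1], so does the bound on the sum, and [psi] is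
     positive at [1]. *)
  have {}p1 : (al l.-1 + be l.-1) * pfrac h1 n1 e1 1 < 1.
    by rewrite -(ltr_pM2l Q1) mulr1 mulrCA -p1.
  have {}p2 : (ga l.+1 + de l.+1) * pfrac h2 n2 e2 1 < 1.
    by rewrite -(ltr_pM2l Q2) mulr1 mulrCA -p2; move: PQ2; rewrite subKn.
  have := dn0 l; rewrite -(ltr_pM2l (dn0 l)) mulr1 in p1 *.
  move: p2; rewrite -(ltr_pM2l (up0 l)) mulr1 => p2 _.
  have := sum1 l; move: p1 p2; rewrite !mulrA [(ga l + de l) * _]mulrC; lra.
pose Q := Qs l.-1; pose Q' := Qr (N - l).
(* The operator of [green_diag], equal to ['X * Q * Q' * psi] away from the poles. The factor
   ['X * Q * Q'] also stands on the other side of that equation and is regular, its zeros being [0]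
   or positive and different from [1]. *)
pose M := 'X * Q * Q' - cross_poly l.-1 * (Ps l.-1 * Q') - cross_poly l * (Q * Pr (N - l)).
have FE' : prodX ls = k *: pfrac_num h ns e.
  by apply: (@poly_eq_cofinite _ _ _ ns) => w wns; rewrite FE // hornerZ horner_pfrac_num // mulrA.
have ME : M * prodX ls = (k *: ('X * Q * Q')) * prodX ns.
  apply: (@poly_eq_cofinite _ _ _ (0 :: 1 :: ls)) => w.
  rewrite !inE !negb_or => /and3P[w0 w1 wls].
  have wn1 : w \notin n1 by apply: contraNN wls => /sub1.
  have wn2 : w \notin n2 by apply: contraNN wls => /sub2.
  have := lq l.-1 _ w0; have := lq l _ w0; have := PE1 w w0 wn1; have := PE2 w w0 wn2.
  rewrite -/Q -/Q' /M -scalerAl; move: (cross_poly l.-1) (cross_poly l) => r1 r2.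
  rewrite !(hornerD, hornerN, hornerM, hornerZ, hornerX) => -> -> -> ->.
  rewrite [RHS](_ : _ = w * Q.[w] * Q'.[w] * (k * (prodX ns).[w])); last by ring.
  rewrite -RE //; ring.
apply: (AM_CM_of_fraction (r := k *: ('X * Q * Q')) H) => //.
  apply: regularZ => //; apply: regularM; first apply: regularM.
  - exact: regularX.
  - rewrite /Q QE1; apply: regularZ => //; apply: regularM; first exact: regularXn.
    apply: regular_prodX => v vn; rewrite (amcm_frac_neq1 H1) //; split=> //.
    by case: H1 => _ _ /(_ _ vn) [].
  - rewrite /Q' QE2; apply: regularZ => //; apply: regularM; first exact: regularXn.
    apply: regular_prodX => v vn; rewrite (amcm_frac_neq1 H2) //; split=> //.
    by case: H2 => _ _ /(_ _ vn) [].
move=> j; rewrite -ME mulrC.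
have D i : act M (G l) i = act (Q * Q' * 'X) (delta0 R) i.
  by rewrite -green_diag /M !cross_polyE prednK.
rewrite (act_eq_mul _ D) FE' -!mul_polyC; congr (act _ _ _); ring.
Qed.

End Solution.
End GreenEquations.

(** * The Green function as a limit of finite sums *)

Section KilledWalk.
Variable R : realType.
Implicit Types (al be ga de : nat -> R) (l : nat).

(* Mass at [(k, j)] after [n] steps of the walk started at [(0, l)], killed at
   level [0]; [k] is shifted by [+1] or [0] in an up_poly step and by [-1] or [0] in
   a down step. *)
Fixpoint alive al be ga de l (n j : nat) (k : int) : R :=
  if n is m.+1 then
    if j is i.+1 then
      al i * alive al be ga de l m i (k - 1) + be i * alive al be ga de l m i k
      + ga i.+2 * alive al be ga de l m i.+2 (k + 1)
      + de i.+2 * alive al be ga de l m i.+2 k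
    else 0
  else ((j == l) && (k == 0))%:R.

Definition green al be ga de l (n j : nat) (k : int) : R :=
  \sum_(m < n) alive al be ga de l m j k.

(** Mass that reaches level [0] within [n] steps, all of it coming from level [1]. *)
Definition absorbed al be ga de l (n : nat) (k : int) : R :=
  ga 1 * green al be ga de l n 1 (k + 1) + de 1 * green al be ga de l n 1 k.

Section Recursion.
Variables (al be ga de : nat -> R) (l : nat).
Hypothesis l0 : (0 < l)%N.
Hypothesis al0 : forall i, 0 <= al i.
Hypothesis be0 : forall i, 0 <= be i.
Hypothesis ga0 : forall i, 0 <= ga i.
Hypothesis de0 : forall i, 0 <= de i.
Hypothesis dn0 : forall i, 0 < ga i + de i.
Notation alive := (alive al be ga de l).
Notation green := (green al be ga de l).
Notation absorbed := (absorbed al be ga de l).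
Hypothesis absorbed_le1 : forall n k, absorbed n k <= 1.

Lemma alive_ge0 n j k : 0 <= alive n j k.
Proof.
by elim: n j k => [|n IH] [|j] k //=; rewrite ?addr_ge0 ?mulr_ge0.
Qed.

Lemma alive0 n k : alive n 0 k = 0.
Proof. by case: n => //=; case: l l0. Qed.

Lemma greenS n j k : green n.+1 j.+1 k = ((j.+1 == l) && (k == 0))%:R
  + (al j * green n j (k - 1) + be j * green n j k
     + ga j.+2 * green n j.+2 (k + 1) + de j.+2 * green n j.+2 k).
Proof.
rewrite /green big_ord_recl /=; congr (_ + _).
by rewrite !mulr_sumr -!big_split.
Qed.

Lemma green_ge0 n j k : 0 <= green n j k.
Proof. by apply: sumr_ge0 => i _; exact: alive_ge0. Qed.

Lemma green_nondecreasing j k : nondecreasing_seq (fun n => green n j k).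
Proof.
apply/nondecreasing_seqP => n.
by rewrite /green big_ord_recr lerDl alive_ge0.
Qed.

Lemma green0 n k : green n 0 k = 0.
Proof. by rewrite /green big1 // => i _; rewrite alive0. Qed.

Let bound_of_down n j C : (forall k, ga j * green n j (k + 1) + de j * green n j k <= C) ->
  forall k, green n j k <= C / (if 0 < de j then de j else ga j).
Proof.
move=> h k; case: ifPn => dj.
  rewrite ler_pdivlMr // mulrC; apply: le_trans (h k).
  by rewrite lerDr mulr_ge0 // green_ge0.
have gj : 0 < ga j.
  move: (dn0 j); rewrite lt_neqAle de0 andbT negbK in dj.
  by rewrite -(eqP dj) addr0.
rewrite ler_pdivlMr // mulrC; apply: le_trans (h (k - 1)).
by rewrite subrK lerDl mulr_ge0 // green_ge0.
Qed.

(** Bounds climb from level to level. The absorbed mass, at most [1], controls level [1]; what flows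
    down from level [j + 2] is part of the mass at level [j + 1], and one of the two down weights is
    positive. The bound depends on the level, but not on [n] or [k]. *)
Lemma green_bounded j : exists C, forall n k, green n j k <= C.
Proof.
elim: j => [|[|j] [C IH]]; first by exists 0 => n k; rewrite green0.
  by eexists => n k; apply: bound_of_down => i; exact: absorbed_le1.
eexists => n k; apply: (@bound_of_down _ _ C) => i.
apply: le_trans (IH n.+1 i); rewrite greenS.
have a1 : 0 <= al j * green n j (i - 1) by rewrite mulr_ge0 ?green_ge0.
have a2 : 0 <= be j * green n j i by rewrite mulr_ge0 ?green_ge0.
have a3 : 0 <= ((j.+1 == l) && (i == 0))%:R :> R by [].
lra.
Qed.

Definition greenoo j k : R := limn (fun n => green n j k).

Lemma cvg_green j k : green n j k @[n --> \oo] --> greenoo j k.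
Proof.
apply: nondecreasing_is_cvgn; first exact: green_nondecreasing.
by have [C hC] := green_bounded j; exists C => _ [n _ <-].
Qed.

Lemma greenoo_ge n j k : green n j k <= greenoo j k.
Proof.
apply: (nondecreasing_cvgn_le (green_nondecreasing j k)).
exact/cvgP/cvg_green.
Qed.

Lemma greenoo0 k : greenoo 0 k = 0.
Proof.
apply/cvg_lim => //; rewrite (_ : (fun n => _) = fun=> 0); first exact: cvg_cst.
by apply/funext => n; rewrite green0.
Qed.

Lemma greenoo_bounded j : bounded_seq (greenoo j).
Proof.
have [C hC] := green_bounded j; exists C => k.
rewrite ger0_norm; last by apply: le_trans (greenoo_ge 0 j k); exact: green_ge0.
apply: (@le_cvg _ (fun n => green n j k) (fun=> C)) => //; first exact: cvg_green.
exact: cvg_cst.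
Qed.

Lemma greenooS j k : act 'X (greenoo j.+1) k =
  (j.+1 == l)%:R * act 'X (delta0 R) k + act ('X * up_poly al be j) (greenoo j) k
  + act (down_poly ga de j.+2) (greenoo j.+2) k.
Proof.
rewrite actXM !actX /up_poly /down_poly !actD !actZ !actC !actX.
have h2 : green n.+1 j.+1 (k - 1) @[n --> \oo] --> greenoo j.+1 (k - 1).
  by rewrite (cvg_shiftS (fun n => green n j.+1 (k - 1))); exact: cvg_green.
rewrite -(cvg_lim _ h2) //; apply/cvg_lim => //.
have -> : (fun n => green n.+1 j.+1 (k - 1)) = fun n => (j.+1 == l)%:R * delta0 R (k - 1)
  + (al j * green n j (k - 1 - 1) + be j * green n j (k - 1)
     + ga j.+2 * green n j.+2 k + de j.+2 * green n j.+2 (k - 1)).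
  by apply/funext => n; rewrite greenS subrK -mulnb natrM.
rewrite (_ : _ + _ + _ = (j.+1 == l)%:R * delta0 R (k - 1)
  + (al j * greenoo j (k - 1 - 1) + be j * greenoo j (k - 1)
     + ga j.+2 * greenoo j.+2 k + de j.+2 * greenoo j.+2 (k - 1))); last by ring.
apply: cvgD; first exact: cvg_cst.
by do ?apply: cvgD; apply: cvgM; (exact: cvg_cst || exact: cvg_green).
Qed.

Lemma cvg_absorbed k : absorbed n k @[n --> \oo] -->
  ga 1 * greenoo 1 (k + 1) + de 1 * greenoo 1 k.
Proof. by apply: cvgD; apply: cvgM; (exact: cvg_cst || exact: cvg_green). Qed.

End Recursion.
End KilledWalk.

(** * Truncation at a high level *)

Section Truncation.
Variable R : realType.
Variables (al be ga de : nat -> R) (l : nat).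
Hypothesis l0 : (0 < l)%N.
Hypothesis al0 : forall i, 0 <= al i.
Hypothesis be0 : forall i, 0 <= be i.
Hypothesis ga0 : forall i, 0 <= ga i.
Hypothesis de0 : forall i, 0 <= de i.
Hypothesis up0 : forall i, 0 < al i + be i.
Hypothesis dn0 : forall i, 0 < ga i + de i.
Hypothesis sum1 : forall i, al i + be i + (ga i + de i) = 1.
Hypothesis absorbed_le1 : forall n k, absorbed al be ga de l n k <= 1.

(** Applied to the weights of the up steps only, so that a walk started at or below [N] is killed
    when it tries to leave level [N] upwards. *)
Definition truncate_at (N : nat) (u : nat -> R) i := if (i < N)%N then u i else 0.

Notation aliveN N := (alive (truncate_at N al) (truncate_at N be) ga de l).
Notation aliveF := (alive al be ga de l).
Notation greenN N := (green (truncate_at N al) (truncate_at N be) ga de l).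
Notation greenF := (green al be ga de l).
Notation greenooN N := (greenoo (truncate_at N al) (truncate_at N be) ga de l).
Notation greenooF := (greenoo al be ga de l).

Lemma truncate_at_ge0 N u : (forall i, 0 <= u i) -> forall i, 0 <= truncate_at N u i.
Proof. by move=> u0 i; rewrite /truncate_at; case: ifP. Qed.

Lemma truncate_at_le N u : (forall i, 0 <= u i) -> forall i, truncate_at N u i <= u i.
Proof. by move=> u0 i; rewrite /truncate_at; case: ifP. Qed.

Let aln N := truncate_at_ge0 N al0.
Let ben N := truncate_at_ge0 N be0.

Lemma aliveN_ge0 N n j k : 0 <= aliveN N n j k.
Proof. exact: alive_ge0. Qed.

Lemma aliveN_le N n j k : aliveN N n j k <= aliveF n j k.
Proof.
elim: n j k => [|n IH] [|j] k //=.
by rewrite !lerD ?ler_pM ?aliveN_ge0 ?aln ?ben ?truncate_at_le.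
Qed.

Lemma alive_far n j k : (l + n < j)%N -> aliveF n j k = 0.
Proof.
elim: n j k => [|n IH] [|j] k //= lj.
  by rewrite gtn_eqF // -(addn0 l).
by rewrite !IH ?mulr0 ?addr0 //; lia.
Qed.

Lemma aliveN_eq N n j k : (l + n <= N)%N -> aliveN N n j k = aliveF n j k.
Proof.
elim: n j k => [|n IH] [|j] k //= lN.
rewrite !IH; try lia; rewrite /truncate_at; case: ltnP => // Nj.
by rewrite !alive_far ?mulr0 //; lia.
Qed.

Lemma aliveN_above N n j k : (l <= N < j)%N -> aliveN N n j k = 0.
Proof.
elim: n j k => [|n IH] j k /andP[lN Nj].
  by rewrite /= gtn_eqF // (leq_ltn_trans lN).
case: j Nj => //= j Nj; rewrite !(IH j.+2) ?lN ?(leqW Nj) //.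
have -> : truncate_at N al j = 0 by rewrite /truncate_at ltnNge -ltnS Nj.
have -> : truncate_at N be j = 0 by rewrite /truncate_at ltnNge -ltnS Nj.
by rewrite !mul0r !mulr0 !addr0.
Qed.

Lemma greenN_le N n j k : greenN N n j k <= greenF n j k.
Proof. by apply: ler_sum => i _; exact: aliveN_le. Qed.

Lemma absorbedN_le1 N n k : absorbed (truncate_at N al) (truncate_at N be) ga de l n k <= 1.
Proof.
by apply: le_trans (absorbed_le1 n k); rewrite lerD // ler_wpM2l // greenN_le.
Qed.

Lemma greenooN_le N j k : greenooN N j k <= greenooF j k.
Proof.
apply: (@le_cvg _ (fun n => greenN N n j k) (fun n => greenF n j k)).
- by move=> n; exact: greenN_le.
- by apply: cvg_green => //; exact: absorbedN_le1.
- exact: cvg_green.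
Qed.

Lemma AM_CM_greenooN N : (l <= N)%N -> AM_CM (greenooN N l).
Proof.
move=> lN; have lN' : (0 < l <= N)%N by rewrite l0.
have hN := @absorbedN_le1 N.
(* The original weights are passed on, since the truncated ones violate positivity of the up steps.
   The equations at levels [1] to [N] involve only up steps from levels below [N] and do not see the
   difference. *)
apply: (@AM_CM_green_diag _ al be ga de l N) => //.
- by move=> k; apply: greenoo0.
- move=> i k iN; rewrite greenooS //; congr (_ + act ('X * _) _ _ + _).
  by rewrite /up_poly /truncate_at iN.
- move=> k; apply/cvg_lim => //; rewrite (_ : (fun n => _) = fun=> 0); first exact: cvg_cst.
  apply/funext => n; rewrite /green big1 // => i _; rewrite aliveN_above //.
  by rewrite lN ltnSn.
- exact: greenoo_bounded.
- exists 0; rewrite gt_eqF //.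
  apply: lt_le_trans (greenoo_ge _ _ _ _ _ _ _ 1 l 0) => //.
  by rewrite /green big_ord1 /= !eqxx.
Qed.

(** In fewer than [N] steps the walk from [l] cannot notice a barrier at [N + l]. So the truncated
    Green function lies between the [N]-th partial sum of the full one and the full one itself. *)
Lemma cvg_greenooN k : greenooN (N + l) l k @[N --> \oo] --> greenooF l k.
Proof.
apply: (@squeeze_cvgr _ _ _ _ (fun N => greenF N l k) (fun=> greenooF l k)).
- apply: nearW => N; rewrite greenooN_le andbT.
  rewrite (_ : greenF N l k = greenN (N + l) N l k); last first.
    by apply: eq_bigr => i _; rewrite aliveN_eq // addnC leq_add2r ltnW.
  by apply: greenoo_ge => //; exact: absorbedN_le1.
- exact: cvg_green.
- exact: cvg_cst.
Qed.

Lemma greenoo_ge0 j k : 0 <= greenooF j k.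
Proof.
by apply: le_trans (greenoo_ge _ _ _ _ _ _ _ 0 j k) => //; rewrite /green big_ord0.
Qed.

Lemma AM_CM_greenoo : AM_CM (greenooF l).
Proof.
have hN N : AM_CM (greenooN (N + l) l) by apply: AM_CM_greenooN; exact: leq_addl.
split.
- by move=> k; exact: greenoo_ge0.
- exists 0; rewrite gt_eqF //.
  apply: lt_le_trans (greenoo_ge _ _ _ _ _ _ _ 1 l 0) => //.
  by rewrite /green big_ord1 /= !eqxx.
- apply: (@completely_monotone_cvg _ (fun N k => greenooN (N + l) l k%:Z)).
    by move=> N; case: (hN N).
  by move=> k; exact: cvg_greenooN.
- apply: (@completely_monotone_cvg _ (fun N k => greenooN (N + l) l (- k%:Z))).
    by move=> N; case: (hN N).
  by move=> k; exact: cvg_greenooN.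
Qed.

(* Decomposition at the last visit to the starting level. *)
Lemma absorption_equation f : (forall k, absorbed al be ga de l n k @[n --> \oo] --> f k) ->
  forall k, act (Qs al be ga de l.-1 * 'X) f k =
            act (\prod_(i < l) down_poly ga de i.+1) (greenooF l) k.
Proof.
move=> hf k.
have fE j : f j = ga 1%N * greenooF 1 (j + 1) + de 1%N * greenooF 1 j.
  rewrite -(cvg_lim _ (hf j)) //; apply/cvg_lim => //; exact: cvg_absorbed.
have fX j : act 'X f j = act (down_poly ga de 1) (greenooF 1) j.
  by rewrite actX fE subrK /down_poly actD actC actZ actX.
rewrite (act_eq_mul _ fX) mulrC.
have ll : (0 < l <= l)%N by rewrite l0 leqnn.
have first i : act (Qs al be ga de l.-1) (greenooF 1) i =
    act (\prod_(i < l.-1) down_poly ga de i.+2) (greenooF l) i.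
  have := @green_first _ al be ga de l l ll greenooF _ _ l.-1 _ i.
  rewrite prednK // => -[] //; first by move=> j; exact: greenoo0.
  by move=> j m jl; exact: greenooS.
rewrite (act_eq_mul _ first); congr (act _ _ _).
by rewrite -(prednK l0) big_ord_recl.
Qed.

End Truncation.

(** * Convolutions and sign changes *)

Section Convolution.
Variable R : realType.
Implicit Types (u v f : int -> R) (k : int) (s : nat -> int).

Lemma esum_series_nneg (g : int -> \bar R) s (a : nat -> R) L :
  injective s -> (forall j, (forall i, s i != j) -> g j = 0%E) ->
  (forall i, 0 <= a i /\ g (s i) = (a i)%:E) ->
  (\sum_(i < n) a i) @[n --> \oo] --> L ->
  (\esum_(j in [set: int]) g j = L%:E)%E.
Proof.
move=> injs g0 ga hL.
have gE : (\esum_(j in [set: int]) g j = \esum_(j in range s) g j)%E.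
  rewrite [RHS]esum_mkcond; apply: eq_esum => j _; case: ifPn => // js.
  apply: g0 => i; apply: contraNneq js => <-.
  by rewrite inE; exists i.
rewrite gE esum_image; last by move=> i j _ _ /injs.
rewrite -nneseries_esumT; last by move=> i; have [a0 ->] := ga i; rewrite lee_fin.
rewrite -(cvg_lim _ hL) // -EFin_lim; last exact: cvgP hL.
congr (limn _); apply/funext => n /=; rewrite big_mkord -sumEFin.
by apply: eq_bigr => i _; have [_ ->] := ga i.
Qed.

Lemma conv_series u v k s (L M : R) : injective s ->
  (forall j, (forall i, s i != j) -> u (k - j) * v j = 0) ->
  (forall n, \sum_(i < n) `|u (k - s i) * v (s i)| <= M) ->
  (\sum_(i < n) u (k - s i) * v (s i)) @[n --> \oo] --> L ->
  Defs.conv u v k = L.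
Proof.
move=> injs supp hM hL; rewrite /Defs.conv.
pose x i := u (k - s i) * v (s i).
have bnd (y : nat -> R) : (forall i, 0 <= y i <= `|x i|) -> cvgn (fun n => \sum_(i < n) y i).
  move=> hy; apply: nondecreasing_is_cvgn.
    apply/nondecreasing_seqP => n.
    by rewrite big_ord_recr lerDl; have /andP[] := hy n.
  exists M => _ [n _ <-]; apply: le_trans (hM n); apply: ler_sum => i _.
  by have /andP[] := hy i.
pose xp i := Num.max (x i) 0; pose xn i := Num.max (- x i) 0.
have cp : cvgn (fun n => \sum_(i < n) xp i).
  by apply: bnd => i; rewrite /xp le_max lexx orbT ge_max ler_norm normr_ge0.
have cn : cvgn (fun n => \sum_(i < n) xn i).
  by apply: bnd => i; rewrite /xn le_max lexx orbT ge_max -normrN ler_norm normr_ge0.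
rewrite (@esum_series_nneg _ s xp _ injs _ _ cp); first last.
- by move=> i; rewrite /xp le_max lexx orbT; split=> //; rewrite funeposE -EFin_max.
- by move=> j js; rewrite funeposE supp // maxxx.
rewrite (@esum_series_nneg _ s xn _ injs _ _ cn); first last.
- by move=> i; rewrite /xn le_max lexx orbT; split=> //; rewrite funenegE -EFinN -EFin_max.
- by move=> j js; rewrite funenegE supp // oppe0 maxxx.
rewrite -EFinB /=; apply: (cvg_unique _ _ hL) => //.
rewrite (_ : (fun n => _) = (fun n => \sum_(i < n) xp i - \sum_(i < n) xn i)).
  exact: cvgB.
apply/funext => n; rewrite -sumrB; apply: eq_bigr => i _; rewrite /xp /xn.
by rewrite -/(x i); case: (leP (x i) 0) => h; case: (leP (- x i) 0) => h'; lra.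
Qed.

Lemma conv_delta0 u : Defs.conv u (delta0 R) = u.
Proof.
apply/funext => k; have injs : injective Posz by move=> i j [].
apply: (@conv_series _ _ _ _ _ `|u k| injs).
- move=> j /(_ `|j|%N) hj; rewrite /delta0; case: eqVneq => [j0|]; last by rewrite mulr0.
  by rewrite j0 in hj.
- case=> [|n]; first by rewrite big_ord0.
  rewrite big_ord_recl big1 ?addr0 => [|i _]; first by rewrite /delta0 /= ?subr0 ?addr0 mulr1.
  by rewrite /delta0 /= mulr0 normr0.
- rewrite -(cvg_shiftS (fun n => \sum_(i < n) _)); apply: cvg_near_cst; apply: nearW => n /=.
  rewrite big_ord_recl big1 ?addr0 => [|i _]; first by rewrite /delta0 /= ?subr0 ?addr0 mulr1.
  by rewrite /delta0 /= mulr0.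
Qed.

Lemma conv_two_point t u :
  Defs.conv (reflection (two_point_seq t)) u = fun k => t * u k + (1 - t) * u (k + 1).
Proof.
apply/funext => k; pose s (i : nat) := k + i%:Z.
have injs : injective s by move=> i j; rewrite /s; lia.
have E i : reflection (two_point_seq t) (k - s i) * u (s i) =
    if i == 0%N then t * u k else if i == 1%N then (1 - t) * u (k + 1) else 0.
  rewrite /reflection /two_point_seq /s (_ : - (k - (k + i%:Z)) = i%:Z); last lia.
  by case: i => [|[|i]] /=; rewrite ?addr0 ?mul0r.
apply: (@conv_series _ _ _ s _ (`|t * u k| + `|(1 - t) * u (k + 1)|) injs).
- move=> j hj; rewrite /reflection /two_point_seq opprB.
  case: eqVneq => [j0|_]; first by have := hj 0%N; rewrite /s; lia.
  case: eqVneq => [j0|_]; first by have := hj 1%N; rewrite /s; lia.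
  by rewrite mul0r.
- case=> [|[|n]]; rewrite ?big_ord0 ?addr_ge0 //.
    by rewrite big_ord1 E lerDl.
  rewrite !big_ord_recl big1 ?addr0 => [|i _]; first by rewrite !E.
  by rewrite E /= normr0.
- rewrite -(cvg_shiftS (fun n => \sum_(i < n) _)) -(cvg_shiftS (fun n => \sum_(i < n.+1) _)).
  apply: cvg_near_cst; apply: nearW => n /=.
  rewrite !big_ord_recl big1 ?addr0 => [|i _]; first by rewrite !E.
  by rewrite E.
Qed.

(** The sum telescopes to [w 0 - p ^+ n * w n], whose last term tends to zero because [w] is
    bounded. *)
Lemma geometric_partial (p M : R) (w x : nat -> R) : 0 < p < 1 ->
  (forall n, `|w n| <= M) -> (forall i, x i = w i - p * w i.+1) ->
  (forall n, \sum_(i < n) `|p ^+ i * x i| <= 2 * M / (1 - p)) /\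
  (\sum_(i < n) p ^+ i * x i) @[n --> \oo] --> w 0%N.
Proof.
move=> /andP[p0 p1] hw hx.
have M0 : 0 <= M by apply: le_trans (hw 0%N).
have p10 : 0 < 1 - p by rewrite subr_gt0.
split=> [n|].
  have hxM i : `|x i| <= 2 * M.
    rewrite hx (le_trans (ler_normB _ _)) // mulr_natl mulr2n lerD //.
    by rewrite normrM gtr0_norm // -[leRHS]mul1r ler_pM // ltW.
  apply: (@le_trans _ _ (\sum_(i < n) 2 * M * p ^+ i)).
    by apply: ler_sum => i _; rewrite normrM normrX gtr0_norm // mulrC ler_wpM2r // exprn_ge0 // ltW.
  rewrite -mulr_sumr ler_wpM2l ?mulr_ge0 // -[leRHS]mul1r ler_pdivlMr //.
  have := subrX1 p n; have : 0 <= p ^+ n by rewrite exprn_ge0 // ltW.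
  by set S := \sum_(i < n) _ => ? ?; nra.
have -> : (fun n => \sum_(i < n) p ^+ i * x i) = fun n => w 0%N - p ^+ n * w n.
  apply/funext; elim=> [|n IH]; first by rewrite big_ord0 expr0 mul1r subrr.
  by rewrite big_ord_recr /= IH hx exprS; ring.
rewrite -[X in _ --> X]subr0; apply: cvgB; first exact: cvg_cst.
have h0 : (M * p ^+ n) @[n --> \oo] --> (0 : R).
  rewrite -[X in _ --> X](mulr0 M); apply: cvgM; first exact: cvg_cst.
  by apply: cvg_expr; rewrite gtr0_norm.
apply: (@squeeze_cvgr _ _ _ _ (fun n => - (M * p ^+ n)) (fun n => M * p ^+ n)) => //.
  apply: nearW => n; rewrite -ler_norml normrM normrX gtr0_norm // mulrC.
  by rewrite ler_wpM2r // exprn_ge0 // ltW.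
by rewrite -[X in _ --> X]oppr0; apply: cvgN.
Qed.

(** The geometric sequence has generating function [1 / (1 - p * w)]. Stating that it undoes this
    linear factor reveals a geometric factor of [u] without evaluating any other convolution. *)
Lemma conv_geometric p u : 0 < p < 1 -> bounded_seq u ->
  Defs.conv (geometric_seq p) (fun k => u k - p * u (k - 1)) = u.
Proof.
move=> p01 [M hM]; apply/funext => k; pose s (i : nat) := k - i%:Z.
have injs : injective s by move=> i j; rewrite /s; lia.
pose w i := u (s i); pose x i := u (s i) - p * u (s i - 1).
have hw n : `|w n| <= M by exact: hM.
have hx i : x i = w i - p * w i.+1 by rewrite /x /w /s; congr (_ - _ * u _); lia.
have [h1 h2] := geometric_partial p01 hw hx.
have E i : geometric_seq p (k - s i) * (u (s i) - p * u (s i - 1)) = p ^+ i * x i.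
  by rewrite /geometric_seq /s (_ : k - (k - i%:Z) = i%:Z) //; lia.
apply: (@conv_series _ _ _ s _ (2 * M / (1 - p)) injs).
- move=> j hj; rewrite /geometric_seq; case: ifP => h; last by rewrite mul0r.
  by have := hj `|k - j|%N; rewrite /s; lia.
- by move=> n; under eq_bigr do rewrite E.
- rewrite (_ : (fun n => _) = fun n => \sum_(i < n) p ^+ i * x i).
    by rewrite (_ : u k = w 0%N) // /w /s subr0.
  by apply/funext => n; apply: eq_bigr => i _; rewrite E.
Qed.

Lemma conv_reflected_geometric p u : 0 < p < 1 -> bounded_seq u ->
  Defs.conv (reflection (geometric_seq p)) (fun k => u k - p * u (k + 1)) = u.
Proof.
move=> p01 [M hM]; apply/funext => k; pose s (i : nat) := k + i%:Z.
have injs : injective s by move=> i j; rewrite /s; lia.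
pose w i := u (s i); pose x i := u (s i) - p * u (s i + 1).
have hw n : `|w n| <= M by exact: hM.
have hx i : x i = w i - p * w i.+1 by rewrite /x /w /s; congr (_ - _ * u _); lia.
have [h1 h2] := geometric_partial p01 hw hx.
have E i : reflection (geometric_seq p) (k - s i) * (u (s i) - p * u (s i + 1)) = p ^+ i * x i.
  by rewrite /reflection /geometric_seq /s (_ : - (k - (k + i%:Z)) = i%:Z) //; lia.
apply: (@conv_series _ _ _ s _ (2 * M / (1 - p)) injs).
- move=> j hj; rewrite /reflection /geometric_seq; case: ifP => h; last by rewrite mul0r.
  by have := hj `|j - k|%N; rewrite /s; lia.
- by move=> n; under eq_bigr do rewrite E.
- rewrite (_ : (fun n => _) = fun n => \sum_(i < n) p ^+ i * x i).
    by rewrite (_ : u k = w 0%N) // /w /s addr0.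
  by apply/funext => n; apply: eq_bigr => i _; rewrite E.
Qed.

End Convolution.

(** * Variation diminishing and a discrete Rolle theorem *)

Section SignChanges.
Variable R : realType.
Implicit Types (u v d : int -> R) (k : int) (p t : R).

Lemma int_ind_up (P : int -> Prop) a b : a <= b -> P a ->
  (forall j, a <= j -> j < b -> P j -> P (j + 1)) -> P b.
Proof.
move=> ab Pa hP; rewrite (_ : b = a + `|b - a|%N%:Z); last by lia.
have : (`|b - a|%N <= `|b - a|%N)%N by [].
elim: {1 3}`|b - a|%N => [|n IH] hn; first by rewrite addr0.
rewrite (_ : a + n.+1%:Z = a + n%:Z + 1); last by lia.
by apply: hP; [lia | lia | apply: IH; lia].
Qed.

(* It suffices to find points where [d] has prescribed alternating signs. *)
Lemma has_sign_changes_of d N (e : nat -> R) (f : nat -> int) :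
  (forall i, (i < N)%N -> e i * e i.+1 < 0) ->
  (forall i, (i < N)%N -> f i <= f i.+1) ->
  (forall i, (i <= N)%N -> 0 < e i * d (f i)) ->
  has_sign_changes d N.
Proof.
move=> he hf hd; exists f => i iN.
have dd : d (f i) * d (f i.+1) < 0.
  have := mulr_gt0 (hd i (ltnW iN)) (hd i.+1 iN).
  by rewrite mulrACA nmulr_rgt0 ?he.
split=> //; rewrite lt_neqAle hf // andbT; apply: contraTneq dd => ->.
by rewrite -expr2 -leNgt sqr_ge0.
Qed.

Lemma has_sign_changes_reflection u N :
  has_sign_changes u N -> has_sign_changes (reflection u) N.
Proof.
move=> [k hk]; exists (fun i => - k (N - i)%N) => i iN.
rewrite /reflection !opprK.
have -> : (N - i = (N - i.+1).+1)%N by lia.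
have [|h1 h2] := hk (N - i.+1)%N; first by lia.
by rewrite ltrN2 mulrC.
Qed.

(** If the difference [d] never had the sign of [u (k i)] between [k (i - 1)] and [k i], then [u (k
    i) * u j <= p * (u (k i) * u (j - 1))] there, and the opposite sign of [u (k (i - 1))] would
    propagate to [k i]. For the first point the inequality is iterated towards minus infinity, and
    boundedness would force [u (k 0) = 0]. *)
Lemma has_sign_changes_geometric u p N : 0 < p < 1 -> bounded_seq u ->
  has_sign_changes u N -> has_sign_changes (fun k => u k - p * u (k - 1)) N.
Proof.
move=> /andP[p0 p1] [M hM]; case: N => [|N] [k hk]; first by exists k.
set d := fun k => _.
have ex i : exists j, (i <= N.+1)%N ->
    [/\ (0 < i)%N -> k i.-1 < j, j <= k i & 0 < u (k i) * d j].
  case: (leqP i N.+1) => iN; last by exists 0.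
  have uk0 : 0 < u (k i) * u (k i).
    rewrite -expr2 exprn_even_gt0 //; case: (ltnP i N.+1) => iN'.
      by have [_] := hk i iN'; apply: contraTneq => ->; rewrite mul0r ltxx.
    have -> : i = N.+1 by apply/eqP; rewrite eqn_leq iN.
    by have [_] := hk N (ltnSn N); apply: contraTneq => ->; rewrite mulr0 ltxx.
  apply: contrapT => /forallNP hj.
  have le j : ((0 < i)%N -> k i.-1 < j) -> j <= k i ->
      u (k i) * u j <= p * (u (k i) * u (j - 1)).
    move=> h1 h2; have := hj j; case: (leP (u (k i) * d j) 0) => h3.
      by move=> _; move: h3; rewrite /d mulrBr mulrCA subr_le0.
    by case=> _; split.
  case: i iN uk0 {hj} le => [|i] iN uk0 le.
    have hn n : u (k 0%N) * u (k 0%N) <= p ^+ n * (u (k 0%N) * u (k 0%N - n%:Z)).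
      elim: n => [|n IH]; first by rewrite expr0 mul1r subr0.
      apply: (le_trans IH); rewrite exprSr -mulrA ler_wpM2l ?exprn_ge0 ?(ltW p0) //.
      rewrite (_ : k 0%N - n.+1%:Z = k 0%N - n%:Z - 1); last by lia.
      by apply: le => //; lia.
    have /eqP : u (k 0%N) * u (k 0%N) = 0.
      apply: (@le_geometric_eq0 _ _ (`|u (k 0%N)| * M) p); first by rewrite ltW.
      move=> n; rewrite gtr0_norm //; apply: (le_trans (hn n)).
      rewrite mulrC ler_wpM2r ?exprn_ge0 ?(ltW p0) //.
      by apply: (le_trans (ler_norm _)); rewrite normrM ler_wpM2l.
    by rewrite gt_eqF.
  have [kk uu] := hk i iN.
  have : u (k i.+1) * u (k i.+1) <= 0.
    apply: (@int_ind_up (fun j => u (k i.+1) * u j <= 0) (k i)); first exact: ltW.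
      by rewrite mulrC ltW.
    move=> j h1 h2 h3; apply: le_trans (le (j + 1) _ _) _ => /=; try lia.
    by rewrite addrK mulr_ge0_le0 // ltW.
  by rewrite leNgt uk0.
have [f hf] := choice ex.
apply: (@has_sign_changes_of _ _ (fun i => u (k i)) f).
- by move=> i iN; have [] := hk i iN.
- move=> i iN; have [_ h1 _] := hf i (ltnW iN); have [/(_ isT) h2 _ _] := hf i.+1 iN.
  exact/ltW/(le_lt_trans h1).
- by move=> i iN; have [] := hf i iN.
Qed.

Lemma has_sign_changes_reflected_geometric u p N : 0 < p < 1 -> bounded_seq u ->
  has_sign_changes u N -> has_sign_changes (fun k => u k - p * u (k + 1)) N.
Proof.
move=> p01 [M hM] /has_sign_changes_reflection hu.
have /(has_sign_changes_geometric p01) h : bounded_seq (reflection u).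
  by exists M => k; exact: hM.
have := has_sign_changes_reflection (h _ hu).
congr (has_sign_changes _ _); apply/funext => k; rewrite /reflection opprK.
by congr (_ - _ * u _); lia.
Qed.

(** A nonzero average has the sign of one of its terms. The chosen points are [k i] or [k i + 1],
    hence increase weakly, which suffices for [has_sign_changes_of]. *)
Lemma has_sign_changes_two_point u t N : 0 <= t <= 1 ->
  has_sign_changes (fun k => t * u k + (1 - t) * u (k + 1)) N -> has_sign_changes u N.
Proof.
move=> /andP[t0 t1]; set v := fun k => _; case: N => [|N] [k hk]; first by exists k.
have ex i : exists j, (i <= N.+1)%N -> k i <= j <= k i + 1 /\ 0 < v (k i) * u j.
  case: (leqP i N.+1) => iN; last by exists 0.
  have vk0 : 0 < v (k i) * v (k i).
    rewrite -expr2 exprn_even_gt0 //; case: (ltnP i N.+1) => iN'.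
      by have [_] := hk i iN'; apply: contraTneq => ->; rewrite mul0r ltxx.
    have -> : i = N.+1 by apply/eqP; rewrite eqn_leq iN.
    by have [_] := hk N (ltnSn N); apply: contraTneq => ->; rewrite mulr0 ltxx.
  have [h|h] := ltP 0 (v (k i) * u (k i)).
    by exists (k i) => _; split=> //; lia.
  have [h'|h'] := ltP 0 (v (k i) * u (k i + 1)).
    by exists (k i + 1) => _; split=> //; lia.
  move: vk0; rewrite {2}/v mulrDr ltNge => /negP[].
  by rewrite mulrCA [v _ * ((1 - t) * _)]mulrCA -[leRHS]addr0 lerD // mulr_ge0_le0 // subr_ge0.
have [f hf] := choice ex.
apply: (@has_sign_changes_of _ _ (fun i => v (k i)) f).
- by move=> i iN; have [] := hk i iN.
- move=> i iN; have [h1 _] := hf i (ltnW iN); have [h2 _] := hf i.+1 iN.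
  by have [h3 _] := hk i iN; lia.
- by move=> i iN; have [] := hf i iN.
Qed.

Lemma iter_fdiff_comb n a b s u k :
  iter n (@fdiff R int) (fun k => a * u k + b * u (k + s)) k =
  a * iter n (@fdiff R int) u k + b * iter n (@fdiff R int) u (k + s).
Proof.
elim: n k => //= n IH k; rewrite /fdiff !IH (addrAC k 1 s); ring.
Qed.

Lemma bounded_iter_fdiff n u : bounded_seq u -> bounded_seq (iter n (@fdiff R int) u).
Proof.
move=> bu; elim: n => //= n IH; apply: bounded_sub => //; exact: bounded_shift.
Qed.

(** The upper bound of [bell_shaped], with order [0] included: this half is transported along the
    convolution factors. *)
Definition diff_variation u :=
  forall n M, has_sign_changes (iter n (@fdiff R int) u) M -> (M <= n)%N.

Lemma diff_variation_geometric u p : 0 < p < 1 -> bounded_seq u ->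
  diff_variation (fun k => u k - p * u (k - 1)) -> diff_variation u.
Proof.
move=> p01 bu hd n M hu; apply: hd.
have := has_sign_changes_geometric p01 (bounded_iter_fdiff n bu) hu.
congr (has_sign_changes _ _); apply/funext => k.
have := iter_fdiff_comb n 1 (- p) (- 1) u k.
rewrite mul1r mulNr => <-; congr (iter _ _ _ _); apply/funext => j.
by rewrite mul1r mulNr.
Qed.

Lemma diff_variation_reflected_geometric u p : 0 < p < 1 -> bounded_seq u ->
  diff_variation (fun k => u k - p * u (k + 1)) -> diff_variation u.
Proof.
move=> p01 bu hd n M hu; apply: hd.
have := has_sign_changes_reflected_geometric p01 (bounded_iter_fdiff n bu) hu.
congr (has_sign_changes _ _); apply/funext => k.
have := iter_fdiff_comb n 1 (- p) 1 u k.
rewrite mul1r mulNr => <-; congr (iter _ _ _ _); apply/funext => j.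
by rewrite mul1r mulNr.
Qed.

Lemma diff_variation_two_point u t : 0 <= t <= 1 ->
  diff_variation u -> diff_variation (fun k => t * u k + (1 - t) * u (k + 1)).
Proof.
move=> t01 hd n M hu; apply: hd; apply: (has_sign_changes_two_point t01).
move: hu; congr (has_sign_changes _ _); apply/funext => k.
exact: iter_fdiff_comb.
Qed.

Lemma iter_fdiff_opp n u m :
  iter n (@fdiff R nat) (fun k : nat => u (- k%:Z)) m =
  (-1) ^+ n * iter n (@fdiff R int) u (- (m + n)%:Z).
Proof.
elim: n m => [|n IH] m; first by rewrite expr0 mul1r addn0.
have e1 : - (m + n.+1)%:Z + 1 = - (m + n)%:Z by lia.
have e2 : - ((m + 1)%R + n)%:Z = - (m + n.+1)%:Z by lia.
by rewrite /= /fdiff !IH e1 e2 exprS; ring.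
Qed.

Lemma iter_fdiff_nat n u m :
  iter n (@fdiff R nat) (fun k : nat => u k%:Z) m = iter n (@fdiff R int) u m%:Z.
Proof.
elim: n m => //= n IH m; rewrite /fdiff !IH.
by rewrite (_ : (m + 1)%R%:Z = m%:Z + 1) //; lia.
Qed.

(** For [n > 0] the difference of order [n] is nonnegative on [j <= - n] and has the sign of
    [(-1) ^+ n] on [j >= 0]. Only [n - 1] indices lie in between, so an alternating chain has at
    most [n + 1] points. *)
Lemma diff_variation_AM_CM u : AM_CM u -> diff_variation u.
Proof.
move=> [u0 _ cmp cmn] n M [k hk]; rewrite leqNgt; apply/negP => nM.
have pos j : 0 <= j -> 0 <= (-1) ^+ n * iter n (@fdiff R int) u j.
  by case: j => // j _; have := cmp n j; rewrite iter_fdiff_nat.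
have neg j : j <= - n%:Z -> 0 <= iter n (@fdiff R int) u j.
  move=> jn; have := cmn n `|(j + n%:Z)%R|%N; rewrite iter_fdiff_opp mulrA -exprMn mulrNN mulr1 expr1n mul1r.
  by rewrite (_ : - (`|(j + n%:Z)%R| + n)%N%:Z = j) //; lia.
case: n nM pos neg hk => [|n] nM pos neg hk.
  by have [_] := hk 0%N nM; rewrite ltNge mulr_ge0 //=; apply: u0.
have k1 : - n%:Z <= k 1%N.
  have [h1 h2] := hk 0%N (leq_ltn_trans (leq0n _) nM).
  have [//|h3] := leP (- n%:Z) (k 1%N).
  by move: h2; rewrite ltNge mulr_ge0 //; apply: neg; lia.
have kn : forall i, (i < M)%N -> - n%:Z + i%:Z <= k i.+1.
  elim=> [|i IH] iM; first by rewrite addr0.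
  by have [h1 _] := hk i.+1 iM; have := IH (ltnW iM); lia.
have nM' : (n < M)%N by apply: leq_trans nM; rewrite ltnS leqnSn.
have kn1 := kn n nM'; rewrite addNr in kn1.
have [h1 h2] := hk n.+1 nM.
have := mulr_ge0 (pos _ kn1) (pos (k n.+2) (ltW (le_lt_trans kn1 h1))).
by rewrite mulrACA -exprMn mulrNN mulr1 expr1n mul1r leNgt h2.
Qed.

Definition vanishing u := u n%:Z @[n --> \oo] --> 0 /\ u (- n%:Z) @[n --> \oo] --> 0.

Lemma vanishing_fdiff u : vanishing u -> vanishing (@fdiff R int u).
Proof.
move=> [hp hn]; split; rewrite /fdiff.
  rewrite -[X in _ --> X](subrr (0 : R)); apply: cvgB => //.
  rewrite (_ : (fun n : nat => u (n%:Z + 1)) = fun n => u n.+1%:Z).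
    by rewrite (cvg_shiftS (fun n => u n%:Z)).
  by apply/funext => n; congr u; lia.
rewrite -[X in _ --> X](subrr (0 : R)).
rewrite -(cvg_shiftS (fun n : nat => u (- n%:Z + 1) - u (- n%:Z))); apply: cvgB.
  rewrite (_ : (fun n : nat => u (- n.+1%:Z + 1)) = fun n => u (- n%:Z)) //.
  by apply/funext => n; congr u; lia.
by rewrite (cvg_shiftS (fun n => u (- n%:Z))).
Qed.

Lemma fdiff_pos_between u c a b : a <= b -> c * u a < c * u b ->
  exists j, a <= j < b /\ 0 < c * @fdiff R int u j.
Proof.
move=> ab hab; apply: contrapT => /forallNP hj.
move: hab; rewrite ltNge => /negP[].
apply: (@int_ind_up (fun j => c * u j <= c * u a) a) => // j h1 h2 h3.
apply: le_trans h3; rewrite -subr_le0 -mulrBr leNgt; apply/negP => h.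
by apply: (hj j); rewrite h1 h2.
Qed.

(** Vanishing at both ends supplies the two outer increments: [u] must leave zero before [k 0] and
    return to it after [k N]. Together with the gaps between consecutive points this gives one sign
    change more. *)
Lemma fdiff_rolle u N : (exists k, u k != 0) -> vanishing u ->
  has_sign_changes u N -> has_sign_changes (@fdiff R int u) N.+1.
Proof.
move=> [k0 uk0] [hp hn] hu.
have [k [hk uk]] : exists k : nat -> int,
    (forall j, (j < N)%N -> k j < k j.+1 /\ u (k j) * u (k j.+1) < 0) /\
    (forall j, (j <= N)%N -> 0 < u (k j) * u (k j)).
  (* For [N = 0] the chain carries no information, and a point where [u] is nonzero takes its
     place. *)
  case: N hu => [|N] [k hk]; first by exists (fun=> k0); split=> // j _; rewrite -expr2 exprn_even_gt0.
  exists k; split=> // i iN; rewrite -expr2 exprn_even_gt0 //.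
  case: (ltnP i N.+1) => iN'.
    by have [_] := hk i iN'; apply: contraTneq => ->; rewrite mul0r ltxx.
  have -> : i = N.+1 by apply/eqP; rewrite eqn_leq iN.
  by have [_] := hk N (ltnSn N); apply: contraTneq => ->; rewrite mulr0 ltxx.
have far (s : nat -> int) c b : u (s n) @[n --> \oo] --> 0 -> 0 < c * b ->
    exists n, forall m, (n <= m)%N -> c * u (s m) < c * b.
  move=> hs cb.
  have : (c * u (s n)) @[n --> \oo] --> (0 : R).
    by rewrite -[X in _ --> X](mulr0 c); apply: cvgM => //; exact: cvg_cst.
  move=> /cvgr_lt /(_ _ cb) [n _ hn']; exists n => m nm; exact: hn'.
(* Sign of the increment on the way to [k i]; the last value belongs to the return to zero beyond
   [k N]. *)
pose e i := if (i <= N)%N then u (k i) else - u (k N).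
have ex i : exists j, (i <= N.+1)%N ->
    [/\ (0 < i)%N -> k i.-1 <= j, (i <= N)%N -> j < k i & 0 < e i * @fdiff R int u j].
  case: (leqP i N.+1) => iN; last by exists 0.
  rewrite /e; case: (leqP i N) => iN'.
    case: i iN iN' => [|i] iN iN'.
      have [n /(_ (maxn n `|k 0%N|)) h] := far _ _ _ hn (uk 0%N iN').
      have [||j [/andP[_ h1] h2]] := @fdiff_pos_between u (u (k 0%N)) (- (maxn n `|k 0%N|)%:Z) (k 0%N).
      - by lia.
      - by apply: h; exact: leq_maxl.
      by exists j => _; split.
    have [kk uu] := hk i iN'.
    have [||j [/andP[h0 h1] h2]] := @fdiff_pos_between u (u (k i.+1)) (k i) (k i.+1).
    - exact: ltW.
    - by apply: lt_trans (uk _ iN'); rewrite mulrC.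
    by exists j => _; split.
  have -> : i = N.+1 by apply/eqP; rewrite eqn_leq iN.
  have [n /(_ (maxn n `|k N|)) h] := far _ _ _ hp (uk N (leqnn _)).
  have [||j [/andP[h0 h1] h2]] := @fdiff_pos_between u (- u (k N)) (k N) (maxn n `|k N|)%:Z.
  - by lia.
  - by rewrite !mulNr ltrN2; apply: h; exact: leq_maxl.
  by exists j => _; split=> //=; rewrite ltnn.
have [f hf] := choice ex.
apply: (@has_sign_changes_of _ _ e f).
- move=> i iN; rewrite /e -ltnS iN; case: (leqP i.+1 N) => iN'.
    by have [] := hk i iN'.
  have -> : i = N by apply/eqP; rewrite eqn_leq -ltnS iN.
  by rewrite mulrN oppr_lt0 uk.
- move=> i iN; have [_ h1 _] := hf i (ltnW iN); have [/(_ isT) h2 _ _] := hf i.+1 iN.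
  exact/ltW/(lt_le_trans (h1 iN)).
- by move=> i iN; have [] := hf i iN.
Qed.

(** Each difference vanishes at both ends and, changing sign, is not identically zero, so every
    further order gains a sign change. *)
Lemma bell_shaped_of u : (forall k, 0 <= u k) -> (exists k, u k != 0) -> vanishing u ->
  diff_variation u -> bell_shaped u.
Proof.
move=> u0 nz hv hd; have [hp hn] := hv; split=> // n n0; split; last exact: hd.
have hvn m : vanishing (iter m (@fdiff R int) u) by elim: m => //= m; exact: vanishing_fdiff.
elim: n n0 => // n IH _ /=; apply: fdiff_rolle => //.
  case: n IH => [|n] // /(_ isT) [k /(_ 0%N isT)[_ h]].
  by exists (k 0%N); apply: contraTneq h => ->; rewrite mul0r ltxx.
by case: n IH => [|n] IH; [exists (fun=> 0)|exact: IH].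
Qed.

End SignChanges.

(** * From the operator identity to the list of factors *)

Section Assembly.
Variable R : realType.
Implicit Types (f g c : int -> R) (tail : seq (int -> R)) (gs rs ts ns s : seq R).

Definition prod_geom gs : {poly R} := \prod_(p <- gs) (1 - p *: 'X).
Definition prod_two_point ts : {poly R} := \prod_(t <- ts) (t *: 'X + (1 - t)%:P).

Lemma convs_geometric gs tail f : {in gs, forall p, 0 < p < 1} -> bounded_seq f ->
  convs tail = act (prod_geom gs) f -> diff_variation (act (prod_geom gs) f) ->
  convs ([seq geometric_seq p | p <- gs] ++ tail) = f /\ diff_variation f.
Proof.
elim: gs f => [|p gs IH] f hgs bf.
  have -> : act (prod_geom [::]) f = f.
    by apply/funext => k; rewrite /prod_geom big_nil act1.
  by [].
have p01 : 0 < p < 1 by apply: hgs; exact: mem_head.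
pose f1 := act (1 - p *: 'X) f.
have f1E : f1 = fun k => f k - p * f (k - 1).
  by apply/funext => k; rewrite /f1 actB act1 actZ actX.
have -> : act (prod_geom (p :: gs)) f = act (prod_geom gs) f1.
  by apply/funext => k; rewrite /prod_geom big_cons mulrC actM.
have hgs' : {in gs, forall q, 0 < q < 1}.
  by move=> q qs; apply: hgs; rewrite in_cons qs orbT.
move=> ht hd; have [ct dv] := IH f1 hgs' (bounded_act _ bf) ht hd.
split.
  by rewrite /= -/(convs _) ct f1E conv_geometric.
by apply: (diff_variation_geometric p01 bf); rewrite -f1E.
Qed.

(** A reflected geometric sequence has generating function ['X / ('X - p)]; the numerators make up
    the shift by [size rs]. *)
Lemma convs_reflected_geometric rs tail f : {in rs, forall p, 0 < p < 1} -> bounded_seq f ->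
  let f' k := act (prodX rs) f (k + (size rs)%:Z) in
  convs tail = f' -> diff_variation f' ->
  convs ([seq reflection (geometric_seq p) | p <- rs] ++ tail) = f /\ diff_variation f.
Proof.
elim: rs f => [|p rs IH] f hrs bf.
  have -> : (fun k => act (prodX [::]) f (k + (size (Nil R))%:Z)) = f.
    by apply/funext => k; rewrite /prodX big_nil act1 addr0.
  by [].
have p01 : 0 < p < 1 by apply: hrs; exact: mem_head.
pose f1 k := act ('X - p%:P) f (k + 1).
have f1E : f1 = fun k => f k - p * f (k + 1).
  by apply/funext => k; rewrite /f1 actB actC actX addrK.
have -> : (fun k => act (prodX (p :: rs)) f (k + (size (p :: rs))%:Z)) =
    fun k => act (prodX rs) f1 (k + (size rs)%:Z).
  apply/funext => k; rewrite prodX_cons mulrC actM /f1 act_shift /=.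
  by congr (act _ _ _); lia.
have hrs' : {in rs, forall q, 0 < q < 1}.
  by move=> q qs; apply: hrs; rewrite in_cons qs orbT.
have bf1 : bounded_seq f1 by exact/bounded_shift/bounded_act.
move=> f' ht hd; have [ct dv] := IH f1 hrs' bf1 ht hd.
split.
  by rewrite /= -/(convs _) ct f1E conv_reflected_geometric.
by apply: (diff_variation_reflected_geometric p01 bf); rewrite -f1E.
Qed.

(** A reflected two-point sequence has generating function [(t * 'X + (1 - t)) / 'X]; the
    denominators make up the shift by [size ts]. *)
Lemma convs_two_points ts c : {in ts, forall t, 0 <= t <= 1} -> diff_variation c ->
  let f k := act (prod_two_point ts) c (k + (size ts)%:Z) in
  convs ([seq reflection (two_point_seq t) | t <- ts] ++ [:: c]) = f /\ diff_variation f.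
Proof.
move=> hts dc; elim: ts hts => [|t ts IH] hts /=.
  have -> : (fun k => act (prod_two_point [::]) c (k + 0%N%:Z)) = c.
    by apply/funext => k; rewrite /prod_two_point big_nil act1 addr0.
  by rewrite conv_delta0.
have t01 : 0 <= t <= 1 by apply: hts; exact: mem_head.
have [|ct dv] := IH.
  by move=> q qs; apply: hts; rewrite in_cons qs orbT.
have -> : (fun k => act (prod_two_point (t :: ts)) c (k + (size ts).+1%:Z)) =
    fun k => t * act (prod_two_point ts) c (k + (size ts)%:Z) +
             (1 - t) * act (prod_two_point ts) c (k + 1 + (size ts)%:Z).
  apply/funext => k; rewrite /prod_two_point big_cons actM actD actZ actC actX.
  by congr (_ * act _ _ _ + _ * act _ _ _); lia.
rewrite -/(convs _) ct conv_two_point; split=> //.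
exact: (diff_variation_two_point t01 dv).
Qed.

(** A root [v < 1] gives a reflected geometric factor of ratio [v]. For [v > 1],
    ['X - v = - v * (1 - v^-1 * 'X)] gives a geometric factor of ratio [v^-1]. *)
Lemma prodX_factor ns : {in ns, forall v, 0 < v /\ v != 1} ->
  exists K, prodX ns = K *: (prodX [seq v <- ns | v < 1]
                             * prod_geom [seq v^-1 | v <- ns & 1 < v]).
Proof.
elim: ns => [|v ns IH] hns.
  by exists 1; rewrite /prodX /prod_geom !big_nil mulr1 scale1r.
have [|K KE] := IH; first by move=> w ws; apply: hns; rewrite in_cons ws orbT.
have [v0 v1] := hns v (mem_head _ _).
rewrite prodX_cons KE /=; have [v_lt1|v_gt1|/eqP] := ltgtP v 1; last by rewrite (negPf v1).
  by exists K; rewrite prodX_cons -scalerAr mulrA.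
exists (- v * K); rewrite /= /prod_geom big_cons -!mul_polyC polyCM polyCN.
have -> : 'X - v%:P = - v%:P * (1 - v^-1%:P * 'X).
  have : v%:P * v^-1%:P = 1 :> {poly R} by rewrite -polyCM mulfV ?gt_eqF.
  move=> h; rewrite (_ : - v%:P * _ = - v%:P + v%:P * v^-1%:P * 'X); last by ring.
  by rewrite h; ring.
ring.
Qed.

(** The parameter [1] stands for the unit mass at [0], which is dropped from the convolution and
    leaves only a power of ['X]. *)
Lemma prod_two_point_factor s :
  prod_two_point s = 'X^(count (pred1 1) s) * prod_two_point [seq t <- s | t != 1].
Proof.
elim: s => [|t s IH]; first by rewrite /prod_two_point !big_nil mulr1.
rewrite /prod_two_point /= big_cons -/(prod_two_point s) IH.
case: eqVneq => [->|_] /=.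
  by rewrite subrr polyC0 addr0 scale1r exprS mulrA.
by rewrite /prod_two_point big_cons mulrCA.
Qed.

Lemma actZr p (a : R) u k : act p (fun j => a * u j) k = a * act p u k.
Proof. by rewrite /act mulr_sumr; apply: eq_bigr => i _; rewrite mulrCA. Qed.

(** The shifts balance: [m + size rs = l - 1], and [size ts] plus the number of dropped parameters
    is [l], so the powers of ['X] left on the two sides are exactly those of the reflected
    factors. *)
Lemma convolution_structure f g (k : R) m l ns (ga de : nat -> R) :
  (0 < l)%N -> bounded_seq f -> AM_CM g ->
  {in ns, forall v, 0 < v /\ v != 1} ->
  (m + count (< 1%R) ns = l.-1)%N ->
  0 < (k *: ('X^m * prodX ns)).[1] ->
  (forall i, 0 <= ga i) -> (forall i, 0 <= de i) -> (forall i, 0 < ga i + de i) ->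
  (forall j, act (k *: ('X^m * prodX ns) * 'X) f j =
             act (\prod_(i < l) ((ga i.+1)%:P + de i.+1 *: 'X)) g j) ->
  let gs := [seq v^-1 | v <- ns & 1 < v] in
  let rs := [seq v <- ns | v < 1] in
  let ts := [seq t <- [seq de i.+1 / (ga i.+1 + de i.+1) | i <- iota 0 l] | t != 1] in
  exists c, [/\ AM_CM c, diff_variation f & convs ([seq geometric_seq p | p <- gs]
                 ++ [seq reflection (geometric_seq p) | p <- rs]
                 ++ [seq reflection (two_point_seq t) | t <- ts]
                 ++ [:: c]) = f].
Proof.
move=> l0 bf ACg hns mE Q1 ga0 de0 dn0 H gs rs ts.
have [K KE] := prodX_factor hns; rewrite -/gs -/rs in KE.
have hrs : {in rs, forall p, 0 < p < 1}.
  by move=> v; rewrite mem_filter => /andP[-> /hns[-> _]].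
have hgs : {in gs, forall p, 0 < p < 1}.
  move=> q /mapP[v]; rewrite mem_filter => /andP[v1 /hns[v0 _]] ->.
  by rewrite invr_gt0 v0 invf_lt1.
have hts0 i : 0 <= de i / (ga i + de i) <= 1.
  rewrite divr_ge0 ?(ltW (dn0 _)) //= ler_pdivrMr // mul1r lerDr //.
have hts : {in ts, forall t, 0 <= t <= 1}.
  by move=> t; rewrite mem_filter => /andP[_ /mapP[i _ ->]].
pose B := \prod_(i < l) (ga i.+1 + de i.+1).
have B0 : 0 < B by apply: prodr_gt0.
have BE : \prod_(i < l) ((ga i.+1)%:P + de i.+1 *: 'X) =
    B *: ('X^(count (pred1 1) [seq de i.+1 / (ga i.+1 + de i.+1) | i <- iota 0 l])
          * prod_two_point ts).
  rewrite -prod_two_point_factor /prod_two_point big_map.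
  rewrite (_ : iota 0 l = index_iota 0 l) ?big_mkord -?scaler_prod; last first.
    by rewrite /index_iota subn0.
  apply: eq_bigr => i _.
  have di := dn0 i.+1; set t := de i.+1 / _.
  have e1 : (ga i.+1 + de i.+1) * t = de i.+1 by rewrite mulrC divfK ?gt_eqF.
  have e2 : (ga i.+1 + de i.+1) * (1 - t) = ga i.+1 by rewrite mulrBr mulr1 e1 addrK.
  by rewrite scalerDr scalerA e1 -[_ *: (1 - t)%:P]mul_polyC -polyCM e2 addrC.
set z := count _ _ in BE.
(* The sign is known only for the product [k * K]; it is read off at [1], where the remaining
   factors are positive. *)
have kK : 0 < k * K.
  move: Q1; rewrite KE !(hornerZ, hornerM, hornerXn) expr1n mul1r.
  rewrite [X in 0 < X -> _]mulrA pmulr_lgt0 //; apply: mulr_gt0.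
    rewrite /prodX horner_prod big_seq prodr_gt0 // => r /hrs /andP[_ r1].
    by rewrite hornerXsubC subr_gt0.
  rewrite /prod_geom horner_prod big_seq prodr_gt0 // => p /hgs /andP[_ p1].
  by rewrite !hornerE subr_gt0.
(* The positive constant is absorbed into the AM-CM factor. *)
pose C := B / (k * K); have C0 : 0 < C by rewrite divr_gt0.
pose c j := C * g j; exists c.
have ACc : AM_CM c.
  case: ACg => g0 [j gj] cp cn; split.
  - by move=> i; rewrite mulr_ge0 // ltW.
  - by exists j; rewrite mulf_neq0 // gt_eqF.
  - by apply: completely_monotoneZ => //; rewrite ltW.
  - by apply: completely_monotoneZ => //; rewrite ltW.
have [] := convs_two_points hts (diff_variation_AM_CM ACc).
set f2 := fun j => act (prod_two_point ts) c _ => ct dv2.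
have bf1 : bounded_seq (act (prod_geom gs) f) by exact: bounded_act.
have key j : act (prodX rs) (act (prod_geom gs) f) (j + (size rs)%:Z) = f2 j.
  have szt : (z + size ts = l)%N.
    by rewrite size_filter /z -[RHS](size_iota 0) -(size_map (fun i => de i.+1 / (ga i.+1 + de i.+1))) count_predC.
  have szr : (m + size rs = l.-1)%N by rewrite size_filter.
  have := H (j + (size rs)%:Z + m.+1%:Z).
  rewrite KE BE -actM (_ : _ * 'X = (k * K) *: ('X^(m.+1) * (prodX rs * prod_geom gs))); last first.
    by rewrite -!mul_polyC polyCM exprSr; ring.
  rewrite !actZ !(actM 'X^_) !actXn addrK => h.
  have kK0 : k * K != 0 by rewrite gt_eqF.
  apply: (mulfI kK0); rewrite h /f2 /c actZr /C mulrA [k * K * _]mulrC divfK //.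
  congr (_ * act _ _ _).
  have idx (a b z' m' l' : nat) (i : int) : (0 < l')%N -> (z' + b = l')%N ->
    (m' + a = l'.-1)%N -> i + a%:Z + m'.+1%:Z - z'%:Z = i + b%:Z by clear; lia.
  exact: idx l0 szt szr.
have := @convs_reflected_geometric rs
  ([seq reflection (two_point_seq t) | t <- ts] ++ [:: c]) _ hrs bf1.
rewrite (_ : (fun k => _) = f2) ?ct; last exact/funext.
move=> /(_ erefl dv2)[cr dvr].
by have [cg dvg] := convs_geometric hgs bf cr dvr.
Qed.

End Assembly.

(** * From the Markov chain to the recursion *)

Section Disintegration.
Context (R : realType) (d : measure_display) (T : measurableType d).
Variables (P : probability T R) (S : countType) (g : T -> S).
Hypothesis mg : forall A : set S, measurable (g @^-1` A).

Lemma prob_countable (A : set T) : measurable A ->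
  P A = (\sum_(n <oo) P (A `&` g @^-1` [set s | pickle s = n]))%E.
Proof.
move=> mA; pose F n := A `&` g @^-1` [set s | pickle s = n].
have mF n : measurable (F n) by exact: measurableI.
rewrite -(@measure_semi_bigcup _ _ _ P F) //.
- congr (P _); apply/seteqP; split=> w; last by case=> n _ [].
  by move=> Aw; exists (pickle (g w)).
- by move=> i j _ _ [w [[_ /= <-] [_ /= <-]]].
- exact: bigcup_measurable.
Qed.

Lemma prob_disintegration (A B : set T) (c : R) : measurable A -> measurable B ->
  (forall s, P (A `&` g @^-1` [set s]) = c%:E * P (B `&` g @^-1` [set s]))%E ->
  P A = (c%:E * P B)%E.
Proof.
move=> mA mB hc; rewrite (prob_countable mA) (prob_countable mB) -nneseriesZl //.
apply: eq_eseriesr => n _; case: (pselect (exists s : S, pickle s = n)) => [[s sn]|hn].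
  have -> : [set s | pickle s = n] = [set s].
    by apply/seteqP; split=> t /=; [rewrite -sn => /(pcan_inj pickleK)|move=> ->].
  exact: hc.
have -> : [set s : S | pickle s = n] = set0.
  by apply/seteqP; split=> t //= tn; apply: hn; exists t.
by rewrite preimage_set0 !setI0 !measure0 mule0.
Qed.

Lemma prob_finite (A : set T) (L : seq S) : measurable A -> uniq L ->
  (forall s, s \notin L -> P (A `&` g @^-1` [set s]) = 0%E) ->
  P A = (\sum_(s <- L) P (A `&` g @^-1` [set s]))%E.
Proof.
move=> mA; elim: L A mA => [|s L IH] A mA uL hA.
  rewrite big_nil (@prob_disintegration A A 0) ?mul0e // => s.
  by rewrite mul0e hA.
have mA' : measurable (A `&` g @^-1` (~` [set s])) by exact: measurableI.
rewrite (measureDI P mA (mg (~` [set s]))) big_cons.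
have /andP[sL uL'] := uL.
have -> : A `\` g @^-1` (~` [set s]) = A `&` g @^-1` [set s].
  by rewrite setDE -preimage_setC setCK.
congr (_ + _)%E.
have hA' t : t \notin L -> P (A `&` g @^-1` (~` [set s]) `&` g @^-1` [set t]) = 0%E.
  move=> tL; have [->|ts] := eqVneq t s.
    by rewrite (_ : _ `&` _ = set0) ?measure0 // -subset0 => w [[_ /= h1] h2].
  rewrite -[RHS](hA t) ?inE ?negb_or ?ts //; congr (P _).
  apply/seteqP; split=> w /=; first by case=> -[].
  by move=> [Aw gw]; do 2!split=> //; rewrite gw; apply/eqP.
apply: etrans (IH _ mA' uL' hA') _.
rewrite big_seq [RHS]big_seq; apply: eq_bigr => t tL; congr (P _).
apply/seteqP; split=> w /=; first by case=> -[].
by move=> [Aw gw]; do 2!split=> //; rewrite gw => ts; rewrite -ts tL in sL.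
Qed.

End Disintegration.

(** * One step of the chain under a constraint on the past *)

Section MarkovChain.
Context (R : realType) (d : measure_display) (T : measurableType d).
Variables (P : probability T R) (S : countType) (Z : nat -> T -> S) (z0 : S).
Variable q : S -> S -> R.
Hypothesis hZ : markov_chain P Z z0 q.

Let mZ n A : measurable (Z n @^-1` A). Proof. by case: hZ. Qed.

Definition before (B : set S) n : set T := [set w | forall m, (m < n)%N -> B (Z m w)].

Lemma measurable_before B n : measurable (before B n).
Proof.
rewrite (_ : before B n = \bigcap_(m in [set m | (m < n)%N]) (Z m @^-1` B)) //.
exact: bigcap_measurableType.
Qed.

(* The constraints [Z m w = y m] of the definition are relaxed to [B] one time
   [m] at a time, by summing over the countably many values of [Z m]. *)
Lemma markov_step B n z z' :
  P (before B n `&` Z n @^-1` [set z] `&` Z n.+1 @^-1` [set z']) =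
  ((q z z')%:E * P (before B n `&` Z n @^-1` [set z]))%E.
Proof.
pose C t (y : nat -> S) := before B t `&`
  [set w | forall m, (t <= m <= n)%N -> Z m w = y m].
have mC t y : measurable (C t y).
  apply: measurableI; first exact: measurable_before.
  rewrite (_ : [set w | _] =
    \bigcap_(m in [set m | (t <= m <= n)%N]) (Z m @^-1` [set y m])) //.
  exact: bigcap_measurableType.
have main t y : (t <= n)%N -> P (C t y `&` Z n.+1 @^-1` [set z']) = ((q (y n) z')%:E * P (C t y))%E.
  elim: t y => [|t IH] y tn.
    have [_ _ /(_ n y z')] := hZ.
    set past := [set w | _] => hq.
    have -> : C 0%N y = past.
      by apply/seteqP; split=> w /=; [move=> [_ h] m mn; exact: h|move=> h; split].
    have mp : measurable past.
      rewrite (_ : past = \bigcap_(m in [set m | (m <= n)%N]) (Z m @^-1` [set y m])) //.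
      exact: bigcap_measurableType.
    (* The Markov property says nothing about a null past, but then both sides vanish. *)
    have [P0|P0] := eqVneq (P past) 0%E.
      rewrite P0 mule0; apply/eqP; rewrite eq_le measure_ge0 andbT -P0.
      by rewrite le_measure ?inE //; exact: measurableI.
    rewrite -hq ?lt0e ?P0 ?measure_ge0 //.
    have mI : measurable (Z n.+1 @^-1` [set z'] `&` past) by exact: measurableI.
    have fI := fin_num_measure P _ mI; have fp := fin_num_measure P _ mp.
    have f0 : fine (P past) != 0.
      by apply: contra P0 => /eqP f0; rewrite -(fineK fp) f0.
    rewrite setIC /cond_prob -[X in (_ * X)%E](fineK fp) -EFinM divfK //.
    by rewrite fineK.
  apply: (@prob_disintegration _ _ _ _ _ (Z t)) => //; first exact: measurableI.
  move=> s; case: (pselect (B s)) => Bs; last first.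
    have e0 : C t.+1 y `&` Z t @^-1` [set s] = set0.
      by rewrite -subset0 => w [[h _] /= sE]; apply: Bs; rewrite -sE; apply: h.
    by rewrite setIAC e0 set0I !measure0 mule0.
  pose y' m := if m == t then s else y m.
  have y'n : y' n = y n by rewrite /y' gtn_eqF.
  have CE : C t.+1 y `&` Z t @^-1` [set s] = C t y'.
    apply/seteqP; split=> w /=.
      move=> [[h1 h2] h3]; split=> [m mt|m /andP[tm mn]]; first by apply: h1; exact: ltnW.
      by rewrite /y'; case: eqVneq => [->//|mt]; apply: h2; rewrite mn ltn_neqAle eq_sym mt tm.
    move=> [h1 h2]; have sE : Z t w = s by rewrite h2 ?leqnn ?(ltnW tn) // /y' eqxx.
    split=> //; split=> [m|m /andP[tm mn]].
      by rewrite ltnS leq_eqVlt => /orP[/eqP ->|/h1 //]; rewrite sE.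
    by rewrite h2 ?mn ?(ltnW tm) // /y' gtn_eqF.
  by rewrite setIAC CE -y'n IH // ltnW.
have E : before B n `&` Z n @^-1` [set z] = C n (fun=> z).
  apply/seteqP; split=> w /= [h1 h2]; split=> //; last by apply: h2; rewrite leqnn.
  by move=> m; rewrite -eqn_leq => /eqP <-.
by rewrite E main.
Qed.

End MarkovChain.

(** * First passage through the masses of the killed walk *)

Section DiagonalWalk.
Context (R : realType) (d : measure_display) (T : measurableType d).
Variables (P : probability T R) (p1 p2 p3 p4 : int -> R) (X Y : nat -> T -> int).
Variables (x y a : int).
Hypothesis hwalk : diagonal_walk P p1 p2 p3 p4 X Y x y.

Let Z n w : int * int := (X n w, Y n w).
Let q := diagonal_step p1 p2 p3 p4.

Let hZ : markov_chain P Z (x, y) q. Proof. by case: hwalk. Qed.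
Let mZ n A : measurable (Z n @^-1` A). Proof. by case: hZ. Qed.

Definition not_passed n : set T := before Z [set s | s.2 != a] n.

(** Time [n] itself is unconstrained, so [mass n i a] is the probability of a first passage at time
    [n] in [(i, a)]. *)
Definition mass n (i j : int) : R := fine (P (not_passed n `&` Z n @^-1` [set (i, j)])).

Let measurable_np n s : measurable (not_passed n `&` Z n @^-1` [set s]).
Proof.
by apply: measurableI => //; exact: (measurable_before hZ).
Qed.

Lemma mass0 i j : mass 0 i j = ((i == x) && (j == y))%:R.
Proof.
rewrite /mass (_ : not_passed 0 = setT) ?setTI; last by apply/seteqP; split.
have h1 : P (Z 0 @^-1` [set (x, y)]) = 1%E by case: hZ.
have [/andP[/eqP -> /eqP ->]|ne] := boolP ((i == x) && (j == y)); first by rewrite h1.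
have : P (Z 0 @^-1` [set (i, j)]) = 0%E.
  apply/eqP; rewrite eq_le measure_ge0 andbT.
  have : P (~` (Z 0 @^-1` [set (x, y)])) = 0%E.
    by rewrite probability_setC // h1 subee.
  move=> <-; rewrite le_measure ?inE //; first exact: measurableC.
  by move=> w /= -> [/eqP ix /eqP jy]; rewrite ix jy in ne.
by move=> ->.
Qed.

Lemma massS n i j : mass n.+1 i j =
  (if j - 1 == a then 0
   else p1 (j - 1) * mass n (i - 1) (j - 1) + p2 (j - 1) * mass n (i + 1) (j - 1)) +
  (if j + 1 == a then 0
   else p3 (j + 1) * mass n (i + 1) (j + 1) + p4 (j + 1) * mass n (i - 1) (j + 1)).
Proof.
pose L := [:: (i - 1, j - 1); (i + 1, j - 1); (i + 1, j + 1); (i - 1, j + 1)].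
have uL : uniq L by rewrite /= !inE !xpair_eqE; lia.
have term s : P (not_passed n.+1 `&` Z n.+1 @^-1` [set (i, j)] `&` Z n @^-1` [set s]) =
    (if s.2 == a then 0 else (q s (i, j) * mass n s.1 s.2)%:E)%E.
  case: ifPn => sa.
    rewrite (_ : _ `&` _ = set0) ?measure0 // -subset0 => w [[h _] sE].
    by have := h n (ltnSn n); rewrite sE /= sa.
  rewrite EFinM /mass fineK; last by apply: fin_num_measure; exact: measurable_np.
  have := @markov_step _ _ _ P _ Z _ q hZ [set s | s.2 != a] n s (i, j).
  rewrite -/(not_passed n) -surjective_pairing => <-; congr (P _).
  apply/seteqP; split=> w /=.
    by move=> [[h1 h2] h3]; do 2!split=> //; move=> m mn; apply: h1; exact: ltnW.
  move=> [[h1 h2] h3]; do 2!split=> //; move=> m.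
  by rewrite ltnS leq_eqVlt => /orP[/eqP -> /=|/h1 //]; rewrite -[Y n w]/(Z n w).2 h2.
rewrite {1}/mass (@prob_finite _ _ _ P _ (Z n) (mZ n) _ L) //.
- rewrite /L !big_cons big_nil adde0 !term.
  have q1 : q (i - 1, j - 1) (i, j) = p1 (j - 1) by rewrite /q /diagonal_step !xpair_eqE ifT //; lia.
  have q2 : q (i + 1, j - 1) (i, j) = p2 (j - 1).
    by rewrite /q /diagonal_step !xpair_eqE ifF ?ifT //; lia.
  have q3 : q (i + 1, j + 1) (i, j) = p3 (j + 1).
    by rewrite /q /diagonal_step !xpair_eqE ifF ?[if _ then p2 _ else _]ifF ?ifT //; lia.
  have q4 : q (i - 1, j + 1) (i, j) = p4 (j + 1).
    rewrite /q /diagonal_step !xpair_eqE ifF ?[if _ then p2 _ else _]ifF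
      ?[if _ then p3 _ else _]ifF ?ifT //; lia.
  rewrite q1 q2 q3 q4 /=; case: ifP => _; case: ifP => _;
    by rewrite ?adde0 ?add0e -?EFinD /= ?add0r ?addr0 ?addrA.
- move=> s sL; rewrite term; case: ifP => // _.
  have -> : q s (i, j) = 0; last by rewrite mul0r.
  case: s sL => s1 s2; rewrite !inE !xpair_eqE /q /diagonal_step !xpair_eqE => sL.
  by do ?[rewrite ifF; last lia].
Qed.

Let passage_set k n : set T := not_passed n `&` Z n @^-1` [set (x + 2 * k + `|y - a|, a)].

Lemma passage_setE k : [set w | exists2 n, passage_time Y a w = Some n &
    (X n w - x - `|y - a|)%:~R / 2 = k%:~R :> R] = \bigcup_n passage_set k n.
Proof.
have eqk n w : ((X n w - x - `|y - a|)%:~R / 2 = k%:~R :> R) <->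
    X n w = x + 2 * k + `|y - a|.
  split=> [h|->].
    have : (X n w - x - `|y - a|)%:~R = (k * 2)%:~R :> R.
      by rewrite intrM -h divfK.
    by move/intr_inj; lia.
  rewrite (_ : x + 2 * k + `|y - a| - x - `|y - a| = k * 2); last by lia.
  by rewrite intrM mulfK.
apply/seteqP; split=> w /=.
  move=> [n]; rewrite /passage_time; case: pselect => // h; case: ex_minnP => m /eqP Ym hm [<-] /eqk Xm.
  exists m => //; split; last by rewrite /= /Z Xm Ym.
  by move=> i im; apply/negP => /hm; rewrite leqNgt im.
move=> [n _ [h1 [h2 h3]]]; exists n; last exact/eqk.
rewrite /passage_time; case: pselect => [h|]; last by case; exists n; rewrite h3.
case: ex_minnP => m Ym hm; congr Some; apply/eqP; rewrite eqn_leq hm ?h3 //=.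
by rewrite leqNgt; apply/negP => /h1; rewrite /= Ym.
Qed.

Let trivIset_passage k : trivIset setT (passage_set k).
Proof.
move=> m n _ _ [w [[h1 [_ h2]] [h3 [_ h4]]]].
have [mn|mn|//] := ltngtP m n; first by have := h3 _ mn; rewrite /= h2 eqxx.
by have := h1 _ mn; rewrite /= h4 eqxx.
Qed.

Lemma cvg_fine_measure (F : nat -> set T) : (forall n, measurable (F n)) ->
  trivIset setT F -> \sum_(m < n) fine (P (F m)) @[n --> \oo] --> fine (P (\bigcup_n F n)).
Proof.
move=> mF tF.
have mU : measurable (\bigcup_n F n) by exact: bigcup_measurable.
have h : (\sum_(0 <= i < n) P (F i))%E @[n --> \oo] --> (fine (P (\bigcup_n F n)))%:E.
  rewrite fineK ?fin_num_measure //; exact: measure_semi_sigma_additive.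
have -> : (fun n => \sum_(m < n) fine (P (F m))) =
    fine \o (fun n => (\sum_(0 <= i < n) P (F i))%E).
  apply/funext => n /=; rewrite big_mkord sum_fine // => i _.
  exact: fin_num_measure.
exact: fine_cvg h.
Qed.

Lemma cvg_passage_pmf k :
  \sum_(m < n) mass m (x + 2 * k + `|y - a|) a @[n --> \oo] --> passage_pmf P X Y x y a k.
Proof.
rewrite /passage_pmf passage_setE; apply: cvg_fine_measure => //.
by move=> n; exact: measurable_np.
Qed.

Lemma passage_pmf_le1 k : passage_pmf P X Y x y a k <= 1.
Proof.
have mU : measurable (\bigcup_n passage_set k n).
  by apply: bigcup_measurable => n _; exact: measurable_np.
rewrite /passage_pmf passage_setE -lee_fin fineK; last exact: fin_num_measure.
exact: probability_le1.
Qed.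

(** Passages at different locations are disjoint events, so the probabilities along any injective
    sequence of locations form a convergent series. *)
Lemma passage_pmf_vanishing : vanishing (passage_pmf P X Y x y a).
Proof.
have mU k : measurable (\bigcup_n passage_set k n).
  by apply: bigcup_measurable => n _; exact: measurable_np.
have dis k k' w : (\bigcup_n passage_set k n) w -> (\bigcup_n passage_set k' n) w -> k = k'.
  move=> [n _ [h1 [h2 h3]]] [m _ [h4 [h5 h6]]].
  have nm : n = m.
    have [mn|mn|//] := ltngtP n m; first by have := h4 _ mn; rewrite /= h3 eqxx.
    by have := h1 _ mn; rewrite /= h6 eqxx.
  by move: h2; rewrite nm h5; lia.
have key (s : nat -> int) : injective s ->
    passage_pmf P X Y x y a (s n) @[n --> \oo] --> (0 : R).
  move=> injs; apply: cvg_series_cvg_0; apply: cvgP.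
  have mF n : measurable (\bigcup_m passage_set (s n) m) by [].
  have tF : trivIset setT (fun n => \bigcup_m passage_set (s n) m).
    by move=> m n _ _ [w [h1 h2]]; apply: injs; exact: dis h1 h2.
  have := cvg_fine_measure mF tF.
  rewrite (_ : (fun n => \sum_(m < n) _) = series (fun n => passage_pmf P X Y x y a (s n))).
    by apply.
  apply/funext => n; rewrite /series /= big_mkord; apply: eq_bigr => m _.
  by rewrite /passage_pmf passage_setE.
by split; apply: key => i j; lia.
Qed.
End DiagonalWalk.

Lemma leq_half_pred (c l : nat) (b : bool) : (0 < l)%N ->
  (c.*2 < l.-1 + b)%N -> (c <= (l - 1) %/ 2)%N.
Proof. by rewrite leq_divRL // muln2; case: b; lia. Qed.

(** * Structure of the absorbed mass *)

Section AbsorbedWalk.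
Variables (R : realType) (al be ga de : nat -> R) (l : nat).
Hypothesis l0 : (0 < l)%N.
Hypothesis al0 : forall i, 0 <= al i.
Hypothesis be0 : forall i, 0 <= be i.
Hypothesis ga0 : forall i, 0 <= ga i.
Hypothesis de0 : forall i, 0 <= de i.
Hypothesis up0 : forall i, 0 < al i + be i.
Hypothesis dn0 : forall i, 0 < ga i + de i.
Hypothesis sum1 : forall i, al i + be i + (ga i + de i) = 1.

(** Walking straight down has positive probability, as one of the two down weights is positive at
    each level. This is why the passage sequence is not identically zero. *)
Lemma alive_descent i : (i < l)%N -> exists k, 0 < alive al be ga de l i (l - i) k.
Proof.
elim: i => [|i IH] il; first by exists 0; rewrite subn0 /= !eqxx.
have [k hk] := IH (ltnW il).
have -> : (l - i.+1 = (l - i.+2).+1)%N by lia.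
have E : (l - i = (l - i.+2).+2)%N by lia.
rewrite E in hk; set j := (l - i.+2)%N in hk *.
have age := alive_ge0 l al0 be0 ga0 de0.
have [g0|g0] := ltP 0 (ga j.+2).
  exists (k - 1) => /=; rewrite subrK ltr_wpDr ?mulr_ge0 //.
  by rewrite ltr_wpDl ?addr_ge0 ?mulr_ge0 // mulr_gt0.
have d0 : 0 < de j.+2 by have := dn0 j.+2; lra.
by exists k; rewrite /= ltr_wpDl ?addr_ge0 ?mulr_ge0 // mulr_gt0.
Qed.

Theorem absorption_structure (f : int -> R) :
  (forall k, absorbed al be ga de l n k @[n --> \oo] --> f k) ->
  (forall k, f k <= 1) -> vanishing f ->
  bell_shaped f /\
  exists (gs rs ts : seq R) (c : int -> R),
    [/\ (forall p, p \in gs -> 0 < p < 1) /\ (size gs <= (l - 1) %/ 2)%N,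
        (forall p, p \in rs -> 0 < p < 1) /\ (size rs <= (l - 1) %/ 2)%N,
        (forall t, t \in ts -> t != 1 /\
           exists2 i, (i < l)%N & t = de i.+1 / (ga i.+1 + de i.+1)) /\ (size ts <= l)%N,
        AM_CM c &
        f = convs ([seq geometric_seq p | p <- gs]
                 ++ [seq reflection (geometric_seq p) | p <- rs]
                 ++ [seq reflection (two_point_seq t) | t <- ts]
                 ++ [:: c])].
Proof.
move=> hf f1 fv.
have age n j k := alive_ge0 l al0 be0 ga0 de0 n j k.
have abs_mono k : nondecreasing_seq (fun n => absorbed al be ga de l n k).
  apply/nondecreasing_seqP => n.
  by rewrite lerD // ler_wpM2l // /green big_ord_recr lerDl.
have abs_le n k : absorbed al be ga de l n k <= f k.
  rewrite -(cvg_lim _ (hf k)) //; apply: nondecreasing_cvgn_le => //.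
  exact: cvgP (hf k).
have abs1 n k : absorbed al be ga de l n k <= 1 by apply: le_trans (f1 k).
have f0 k : 0 <= f k.
  apply: le_trans (abs_le 0%N k).
  by rewrite addr_ge0 ?mulr_ge0 // /green big_ord0.
have fnz : exists k, f k != 0.
  have [|k hk] := @alive_descent l.-1; first by rewrite prednK.
  have {}hk : 0 < green al be ga de l l 1 k.
    have E : (l - l.-1 = 1)%N by lia.
    rewrite E in hk; have pl : (l.-1 < l)%N by rewrite prednK.
    apply: lt_le_trans hk _.
    by rewrite /green (bigD1 (Ordinal pl)) //= lerDl sumr_ge0.
  have gge j : 0 <= green al be ga de l l 1 j by rewrite sumr_ge0.
  have [g0|g0] := ltP 0 (ga 1%N).
    exists (k - 1); rewrite gt_eqF //; apply: lt_le_trans (abs_le l (k - 1)).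
    by rewrite /absorbed subrK ltr_wpDr ?mulr_gt0 // mulr_ge0.
  exists k; rewrite gt_eqF //; apply: lt_le_trans (abs_le l k).
  have d0 : 0 < de 1%N by have := dn0 1; lra.
  by rewrite /absorbed ltr_wpDl ?mulr_gt0 // mulr_ge0.
have bf : bounded_seq f by exists 1 => k; rewrite ger0_norm.
have ACg := AM_CM_greenoo l0 al0 be0 ga0 de0 up0 dn0 sum1 abs1.
have H := absorption_equation l0 al0 be0 ga0 de0 dn0 abs1 hf.
have [h [ns [e [k [m [Hfr k0 QE _ [mE cl cg]]]]]]] :=
  amcm_frac_cont al0 be0 ga0 de0 up0 dn0 sum1 l.-1.
have hns : {in ns, forall v, 0 < v /\ v != 1}.
  move=> v vns; rewrite (amcm_frac_neq1 Hfr) //; split=> //.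
  by case: Hfr => _ _ /(_ _ vns) [].
have [Q1 _] := Qs_gt0 al0 be0 dn0 sum1 l.-1.
rewrite QE in H Q1.
have [c [ACc dv cE]] := convolution_structure l0 bf ACg hns mE Q1 ga0 de0 dn0 H.
split; first exact: bell_shaped_of.
have half (cnt : nat) (b : bool) : (cnt.*2 < l.-1 + b)%N -> (cnt <= (l - 1) %/ 2)%N.
  exact: leq_half_pred.
exists [seq v^-1 | v <- ns & 1 < v], [seq v <- ns | v < 1],
  [seq t <- [seq de i.+1 / (ga i.+1 + de i.+1) | i <- iota 0 l] | t != 1], c.
split=> //.
- split; last by rewrite size_map size_filter; exact: half cg.
  move=> p /mapP[v]; rewrite mem_filter => /andP[v1 /hns[v0 _]] ->.
  by rewrite invr_gt0 v0 invf_lt1.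
- split; last by rewrite size_filter; exact: half cl.
  by move=> v; rewrite mem_filter => /andP[-> /hns[-> _]].
- split; last by rewrite size_filter (leq_trans (count_size _ _)) // size_map size_iota.
  move=> t; rewrite mem_filter => /andP[t1 /mapP[i]]; rewrite mem_iota => il tE.
  by split=> //; exists i.
Qed.

End AbsorbedWalk.

(** * From the plane to level coordinates *)

Section LevelCoordinates.
Variables (R : realType) (p1 p2 p3 p4 : int -> R) (x y a : int) (l : nat).
Variable w : nat -> int -> int -> R.
Hypothesis yE : y = a + l%:Z.
Hypothesis l0 : (0 < l)%N.
Hypothesis w0 : forall i j, w 0 i j = ((i == x) && (j == y))%:R.
Hypothesis wS : forall n i j, w n.+1 i j =
  (if j - 1 == a then 0
   else p1 (j - 1) * w n (i - 1) (j - 1) + p2 (j - 1) * w n (i + 1) (j - 1)) +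
  (if j + 1 == a then 0
   else p3 (j + 1) * w n (i + 1) (j + 1) + p4 (j + 1) * w n (i - 1) (j + 1)).

Let al (j : nat) := p1 (a + j%:Z).
Let be (j : nat) := p2 (a + j%:Z).
Let ga (j : nat) := p3 (a + j%:Z).
Let de (j : nat) := p4 (a + j%:Z).

(* The walk cannot jump over level [a]. *)
Lemma mass_beyond n i j : j < a -> w n i j = 0.
Proof.
elim: n i j => [|n IH] i j ja.
  by rewrite w0 (_ : j == y = false) ?andbF //; lia.
rewrite wS !(IH _ (j - 1)); try lia.
rewrite !mulr0 addr0 if_same add0r; case: eqVneq => // ja1.
by rewrite !IH ?mulr0 ?addr0 //; lia.
Qed.

(** Steps up to the right and down to the left change [k] by one; the other two keep it. Horizontal
    and vertical parity change together, so every reachable point has this form. *)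
Lemma mass_alive n j k i' j' : i' = x + 2 * k + l%:Z - j.+1%:Z -> j' = a + j.+1%:Z ->
  w n i' j' = alive al be ga de l n j.+1 k.
Proof.
elim: n j k i' j' => [|n IH] j k i' j' -> ->.
  by rewrite w0 /=; congr ((_ : bool)%:R); lia.
rewrite wS /=.
have -> : (a + j.+1%:Z + 1 == a) = false by lia.
rewrite [w n (_ + 1) (_ + 1)](IH j.+1 (k + 1)); try lia.
rewrite [w n (_ - 1) (_ + 1)](IH j.+1 k); try lia.
rewrite [p3 _](_ : _ = ga j.+2); last by rewrite /ga; congr p3; lia.
rewrite [p4 _](_ : _ = de j.+2); last by rewrite /de; congr p4; lia.
rewrite -[RHS]addrA; congr (_ + _).
case: j => [|j].
  by rewrite addrK eqxx !alive0 // !mulr0 addr0.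
have -> : (a + j.+2%:Z - 1 == a) = false by lia.
rewrite [w n (_ - 1) (_ - 1)](IH j (k - 1)); try lia.
rewrite [w n (_ + 1) (_ - 1)](IH j k); try lia.
rewrite [p1 _](_ : _ = al j.+1); last by rewrite /al; congr p1; lia.
by rewrite [p2 _](_ : _ = be j.+1) //; rewrite /be; congr p2; lia.
Qed.

Lemma sum_mass_absorbed n k :
  \sum_(m < n.+1) w m (x + 2 * k + l%:Z) a = absorbed al be ga de l n k.
Proof.
(* Time [0] contributes nothing, as the walk does not start on level [a]; hence the index [n.+1]. *)
rewrite big_ord_recl w0 (_ : a == y = false) ?andbF ?add0r; last by lia.
rewrite /absorbed /green !mulr_sumr -big_split; apply: eq_bigr => m _ /=.
rewrite wS (_ : a + 1 == a = false); last by lia.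
rewrite !(mass_beyond _ _ (_ : a - 1 < a)); try lia.
rewrite !mulr0 addr0 if_same add0r.
rewrite [w m (_ + 1) _](@mass_alive m 0 (k + 1)); try lia.
rewrite [w m (_ - 1) _](@mass_alive m 0 k); try lia.
by rewrite /ga /de.
Qed.

End LevelCoordinates.

Theorem theorem1p1 (R : realType) (d : measure_display) (T : measurableType d)
    (P : probability T R) (p1 p2 p3 p4 : int -> R) (X Y : nat -> T -> int)
    (x y a : int)
    (hwalk : diagonal_walk P p1 p2 p3 p4 X Y x y)
    (hup : forall j, 0 < p1 j + p2 j)
    (hdown : forall j, 0 < p3 j + p4 j)
    (hay : a <> y) :
  bell_shaped (passage_pmf P X Y x y a) /\
  exists (gs rs ts : seq R) (c : int -> R),
    [/\ (forall p, p \in gs -> 0 < p < 1) /\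
          (size gs <= (`|y - a|%N - 1) %/ 2)%N,
        (forall p, p \in rs -> 0 < p < 1) /\
          (size rs <= (`|y - a|%N - 1) %/ 2)%N,
        (forall t, t \in ts -> two_point_parameter p1 p4 y a t) /\
          (size ts <= `|y - a|)%N,
        AM_CM c &
        forall k, passage_pmf P X Y x y a k =
          convs ([seq geometric_seq p | p <- gs]
                 ++ [seq reflection (geometric_seq p) | p <- rs]
                 ++ [seq reflection (two_point_seq t) | t <- ts]
                 ++ [:: c]) k].
Proof.
have [hp sump _] := hwalk.
set l := `|y - a|%N; set f := passage_pmf P X Y x y a.
have l0 : (0 < l)%N by rewrite /l; lia.
have fv : vanishing f by exact: (passage_pmf_vanishing a hwalk).
have f1 k : f k <= 1 by exact: (passage_pmf_le1 a hwalk).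
have hf k : \sum_(m < n.+1) mass P X Y a m (x + 2 * k + l%:Z) a @[n --> \oo] --> f k.
  rewrite (cvg_shiftS (fun n => \sum_(m < n) mass P X Y a m (x + 2 * k + l%:Z) a)).
  by rewrite (_ : l%:Z = `|y - a|); [exact: (cvg_passage_pmf hwalk) | rewrite abszE].
have wrap (al be ga de : nat -> R) :
    (forall i, [/\ 0 <= al i, 0 <= be i, 0 <= ga i & 0 <= de i]) ->
    (forall i, [/\ 0 < al i + be i, 0 < ga i + de i & al i + be i + (ga i + de i) = 1]) ->
    (forall n k, \sum_(m < n.+1) mass P X Y a m (x + 2 * k + l%:Z) a
                 = absorbed al be ga de l n k) ->
    (forall i, (i < l)%N -> de i.+1 = 0 ->
       exists j, (y <= j < a) && (p1 j == 0) || (a < j <= y) && (p4 j == 0)) ->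
    bell_shaped f /\ exists (gs rs ts : seq R) (c : int -> R),
    [/\ (forall p, p \in gs -> 0 < p < 1) /\ (size gs <= (l - 1) %/ 2)%N,
        (forall p, p \in rs -> 0 < p < 1) /\ (size rs <= (l - 1) %/ 2)%N,
        (forall t, t \in ts -> two_point_parameter p1 p4 y a t) /\ (size ts <= l)%N,
        AM_CM c &
        forall k, f k = convs ([seq geometric_seq p | p <- gs]
                 ++ [seq reflection (geometric_seq p) | p <- rs]
                 ++ [seq reflection (two_point_seq t) | t <- ts]
                 ++ [:: c]) k].
  move=> hpos hsum habs hzero.
  have hf' k : absorbed al be ga de l n k @[n --> \oo] --> f k.
    have -> : (fun n => absorbed al be ga de l n k) =
      fun n => \sum_(m < n.+1) mass P X Y a m (x + 2 * k + l%:Z) a by apply/funext.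
    exact: hf.
  have al0 i : 0 <= al i by case: (hpos i).
  have be0 i : 0 <= be i by case: (hpos i).
  have ga0 i : 0 <= ga i by case: (hpos i).
  have de0 i : 0 <= de i by case: (hpos i).
  have up0 i : 0 < al i + be i by case: (hsum i).
  have dn0 i : 0 < ga i + de i by case: (hsum i).
  have sum1 i : al i + be i + (ga i + de i) = 1 by case: (hsum i).
  have [B [gs [rs [ts [c [h1 h2 [h3 h3'] h4 h5]]]]]] :=
    absorption_structure l0 al0 be0 ga0 de0 up0 dn0 sum1 hf' f1 fv.
  split=> //; exists gs, rs, ts, c; split=> //; last by move=> k; rewrite [in LHS]h5.
  split=> // t /h3 [t1 [i il tE]]; split.
  - by rewrite tE divr_ge0 // ltW.
  - by rewrite lt_neqAle t1 tE ler_pdivrMr // mul1r /= lerDr.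
  - rewrite tE => /eqP; rewrite mulf_eq0 invr_eq0 (gt_eqF (dn0 _)) orbF => /eqP.
    exact: hzero.
have [ya|ya|ya] := ltgtP a y; last by rewrite ya in hay.
- have yE : y = a + l%:Z by rewrite /l; lia.
  apply: (wrap (fun j => p1 (a + j%:Z)) (fun j => p2 (a + j%:Z))
               (fun j => p3 (a + j%:Z)) (fun j => p4 (a + j%:Z))).
  + by move=> i; exact: hp.
  + by move=> i; rewrite addrA sump; split.
  + move=> n k; apply: (@sum_mass_absorbed _ p1 p2 p3 p4 x y a l _ yE l0).
      by move=> i j; rewrite (mass0 a hwalk).
    by move=> m i j; rewrite (massS a hwalk).
  + by move=> i il hi; exists (a + i.+1%:Z); rewrite hi eqxx; lia.
(* Reflecting the second coordinate puts the start above the target and exchanges [p1] with [p4] and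
   [p2] with [p3]. *)
- have yE : - y = - a + l%:Z by rewrite /l; lia.
  apply: (wrap (fun j => p4 (- (- a + j%:Z))) (fun j => p3 (- (- a + j%:Z)))
               (fun j => p2 (- (- a + j%:Z))) (fun j => p1 (- (- a + j%:Z)))).
  + by move=> i; have [] := hp (- (- a + i%:Z)).
  + move=> i; set j := - _; split; rewrite 1?addrC //.
    by have := sump j; lra.
  + move=> n k; rewrite -(@sum_mass_absorbed _ (fun j => p4 (- j)) (fun j => p3 (- j))
      (fun j => p2 (- j)) (fun j => p1 (- j)) x (- y) (- a) l
      (fun n i j => mass P X Y a n i (- j)) yE l0).
    * by apply: eq_bigr => m _; rewrite opprK.
    * by move=> i j; rewrite (mass0 a hwalk) eqr_oppLR.
    * move=> m i j; rewrite (massS a hwalk).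
      have -> : - j - 1 = - (j + 1) by lia.
      have -> : - j + 1 = - (j - 1) by lia.
      rewrite !eqr_oppLR addrC.
      by congr (_ + _); case: ifP => // _; rewrite addrC.
  + move=> i il hi; exists (- (- a + i.+1%:Z)); rewrite hi eqxx; lia.
Qed.
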